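(* Let $A,B,C\in\mathbb{C}^{N\times N}$ be pairwise commuting positive stable matrices such that $B-A$ and $C-A$ are positive stable and invertible. Then for all $z\in\mathbb{C}\setminus[1,\infty)$, $${}_1F_2(A;B,C;z)=\Gamma(B)\Gamma^{-1}(A)\Gamma^{-1}(B-A)\int_0^1 t^{A-I}(1-t)^{B-A-I}\,{}_0F_1(-;C;zt)\,dt$$ and $${}_1F_2(A;B,C;z)=\Gamma(C)\Gamma^{-1}(A)\Gamma^{-1}(C-A)\int_0^1 t^{A-I}(1-t)^{C-A-I}\,{}_0F_1(-;B;zt)\,dt .$$
   Context: $I$ is the $N\times N$ identity matrix. A matrix is positive stable if all its eigenvalues have positive real part. For $M\in\mathbb{C}^{N\times N}$, $(M)_0=I$, $(M)_k=M(M+I)\cdots(M+(k-1)I)$ for $k\ge1$; for $t>0$, $t^M=\exp(M\ln t)$. For $M$ positive stable $\Gamma(M)=\int_0^\infty e^{-t}t^{M-I}\,dt$, and $\Gamma^{-1}(M)$ is its inverse. The functions are ${}_1F_2(A;B,C;z)=\sum_{k\ge0}\frac{z^k}{k!}(A)_k[(B)_k]^{-1}[(C)_k]^{-1}$ and ${}_0F_1(-;C;z)=\sum_{k\ge0}\frac{z^k}{k!}[(C)_k]^{-1}$. *)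

(* Defs.v *)
From HB Require Import structures.
From mathcomp Require Export all_boot all_order all_algebra.
From mathcomp Require Export complex.
From mathcomp Require Export all_classical all_reals all_analysis.
Export Order.TTheory GRing.Theory Num.Theory numFieldNormedType.Exports.

Set Implicit Arguments.
Unset Strict Implicit.
Unset Printing Implicit Defensive.

Local Open Scope classical_set_scope.
Local Open Scope ring_scope.
Local Open Scope complex_scope.

(* Limits are in the max-norm topology of 'M[K]_N, i.e. entrywise for `| |.
   K is only ever R[i] below; keeping it abstract spares unification from
   unfolding the field structure of R[i]. *)
Section Series.
Context {K : numFieldType} {N : nat}.
Local Notation mx := 'M[K]_N.

Definition mxexp (M : mx) : mx :=
  limn (series (fun k : nat => (k`!%:R : K)^-1 *: M ^+ k)).

Definition poch (M : mx) (k : nat) : mx :=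
  \prod_(i < k) (M + (i%:R : K)%:M).

Definition mx1F2 (A B C : mx) (z : K) : mx :=
  limn (series (fun k : nat =>
    (z ^+ k / k`!%:R) *: (poch A k *m invmx (poch B k) *m invmx (poch C k)))).

Definition mx0F1 (C : mx) (z : K) : mx :=
  limn (series (fun k : nat => (z ^+ k / k`!%:R) *: invmx (poch C k))).

End Series.

Section MatrixFunctions.
Context {R : realType} {N : nat}.
Local Notation mx := 'M[R[i]]_N.
Local Notation mu := (@lebesgue_measure R).

Definition positive_stable (M : mx) : Prop :=
  forall a : R[i], eigenvalue M a -> 0 < complex.Re a.

(* t^M, meaningful for t > 0 only: ln t = 0 for t <= 0. *)
Definition mxpow (t : R) (M : mx) : mx := mxexp ((ln t)%:C *: M).

(* Integrals of matrix functions are taken entry by entry, on real and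
   imaginary parts; Rintegral is total, so integrability is a separate
   predicate. *)
Definition mx_integrable (D : set R) (F : R -> mx) : Prop :=
  forall i j,
    mu.-integrable D (EFin \o (fun t => complex.Re (F t i j))) /\
    mu.-integrable D (EFin \o (fun t => complex.Im (F t i j))).

Definition mx_integral (D : set R) (F : R -> mx) : mx :=
  \matrix_(i, j)
    ((\int[mu]_(t in D) complex.Re (F t i j))
     +i* (\int[mu]_(t in D) complex.Im (F t i j))).

Definition mxGamma (M : mx) : mx :=
  mx_integral `]0, +oo[ (fun t => (expR (- t))%:C *: mxpow t (M - 1%:M)).

End MatrixFunctions.

(* Main.v *)
From HB Require Import structures.
Require Import Defs.
From mathcomp Require Import ring lra measurable_realfun.

Set Implicit Arguments.
Unset Strict Implicit.
Unset Printing Implicit Defensive.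

Local Open Scope classical_set_scope.
Local Open Scope ring_scope.
Local Open Scope complex_scope.

(** Expand the 0F1 factor in powers of t and integrate term by term. The k-th
    term involves the Beta integral B(A + k, B - A), and

      B(A + k, B - A) = (A)_k (B)_k^-1 B(A, B - A),

    so the integral is B(A, B - A) times the 1F2 series. It remains to know that
    B(A, B - A) = Gamma(B)^-1 Gamma(A) Gamma(B - A) with all three Gammas
    invertible. The second formula is the first one with B and C exchanged.

    Convergence and domination rest on one estimate. If M is positive stable then
    |t^M| <= c t^alpha on (0, 1] for some alpha > 0 ([mpow_decay]). By
    Cayley-Hamilton the product of the M - a over the eigenvalues a vanishes;
    the bound is proved by removing these factors one at a time, each removal
    being one integration of a scalar exponential ([mxexp_decay_factors]).

    The recurrences of the Beta integral ([mxBeta_pochl], [mxBeta_pochr]) express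
    that the derivative of t^P (1 - t)^Q integrates to zero over (0, 1)
    ([mxBeta_balance]).

    Gamma enters as a limit of Beta integrals. After the substitution t = s / n,
    dominated convergence gives n^P B(P, Q + n + 1) --> Gamma(P)
    ([cvg_mxBeta_mGamma]). For Q = 0 the left-hand side is explicit, which
    is Euler's formula Gamma(P) = lim n! n^P (P)_(n+1)^-1 ([cvg_euler_term]).
    The inverses of these approximants are bounded, because consecutive ones
    differ by a factor 1 + O(n^-2) ([euler_inv_bounded]); hence Gamma(P) is
    invertible ([mGamma_unit]). For positive stable Q the recurrence of Beta
    turns the same limit into Gamma(P + Q) B(P, Q) = Gamma(Q) Gamma(P)
    ([mxBeta_mGamma]).

    The topology and the integrals are entrywise, so the analysis is done on the
    real and imaginary parts of the entries, with a norm that is submultiplicative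
    on matrices. *)

(** * Real coordinates and a submultiplicative norm *)

(** Locked, so that comparing two scalings never unfolds the field structure of
    the complex numbers. *)
HB.lock Definition rscale {R : realType} {N : nat} (a : R) (M : 'M[R[i]]_N) : 'M[R[i]]_N :=
  a%:C *: M.

Notation "a *:r M" := (rscale a M) (at level 40, left associativity) : ring_scope.

Section RealScaling.
Context {R : realType} {N : nat}.
Implicit Types (a b : R) (X Y : 'M[R[i]]_N).

Lemma rscaleE a X : a *:r X = a%:C *: X. Proof. by rewrite unlock. Qed.

Lemma rscaleA a b X : a *:r (b *:r X) = (a * b) *:r X.
Proof. by rewrite !rscaleE scalerA rmorphM. Qed.

Lemma rscale0 X : 0 *:r X = 0. Proof. by rewrite rscaleE scale0r. Qed.

Lemma rscaler0 a : a *:r (0 : 'M[R[i]]_N) = 0. Proof. by rewrite rscaleE scaler0. Qed.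

Lemma rscale1 X : 1 *:r X = X. Proof. by rewrite rscaleE scale1r. Qed.

Lemma rscaleNr a X : (- a) *:r X = - (a *:r X).
Proof. by rewrite !rscaleE rmorphN scaleNr. Qed.

Lemma rscalerN a X : a *:r (- X) = - (a *:r X).
Proof. by rewrite !rscaleE scalerN. Qed.

Lemma rscaleDl a b X : (a + b) *:r X = a *:r X + b *:r X.
Proof. by rewrite !rscaleE rmorphD scalerDl. Qed.

Lemma rscaleBl a b X : (a - b) *:r X = a *:r X - b *:r X.
Proof. by rewrite rscaleDl rscaleNr. Qed.

Lemma rscaleDr a X Y : a *:r (X + Y) = a *:r X + a *:r Y.
Proof. by rewrite !rscaleE scalerDr. Qed.

Lemma rscaleMl a X Y : (a *:r X) *m Y = a *:r (X *m Y).
Proof. by rewrite !rscaleE scalemxAl. Qed.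

Lemma rscaleMr a X Y : X *m (a *:r Y) = a *:r (X *m Y).
Proof. by rewrite !rscaleE scalemxAr. Qed.

End RealScaling.

Section Coordinates.
Context {R : realType} {N : nat}.
Local Notation mx := 'M[R[i]]_N.

Definition cidx := (bool * ('I_N * 'I_N))%type.

(** Real and imaginary parts are indexed together by a boolean, so that an
    entrywise statement is a single statement over a finite type. *)
Definition coord (k : cidx) (M : mx) : R :=
  if k.1 then complex.Im (M k.2.1 k.2.2) else complex.Re (M k.2.1 k.2.2).

Lemma coord_inj (X Y : mx) : (forall k, coord k X = coord k Y) -> X = Y.
Proof.
move=> h; apply/matrixP => i j; apply/eqP; rewrite eq_complex.
by apply/andP; split; apply/eqP; [have := h (false, (i, j))|have := h (true, (i, j))].
Qed.

Lemma coord_is_zmod_morphism k : zmod_morphism (coord k).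
Proof.
move=> X Y; rewrite /coord !mxE.
by case: (X _ _) => a b; case: (Y _ _) => c d; case: k.1.
Qed.

HB.instance Definition _ k :=
  GRing.isZmodMorphism.Build mx R (coord k) (coord_is_zmod_morphism k).

Lemma coordZ k (a : R) (X : mx) : coord k (a *:r X) = a * coord k X.
Proof.
rewrite rscaleE /coord !mxE; case: (X _ _) => x y; case: k.1 => /=;
by rewrite !mul0r ?subr0 ?addr0.
Qed.

(** The sign is that of the square of the imaginary unit: it is -1 exactly when
    two imaginary parts contribute to a real one. *)
Lemma coordM c i j (X Y : mx) : coord (c, (i, j)) (X *m Y) =
  \sum_k (coord (c, (i, k)) X * coord (false, (k, j)) Y
          + (-1) ^+ (~~ c) * coord (~~ c, (i, k)) X * coord (true, (k, j)) Y).
Proof.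
have ReS (f : 'I_N -> R[i]) : complex.Re (\sum_k f k) = \sum_k complex.Re (f k).
  by apply: (big_morph _ _ (erefl _)) => -[a b] [c' d].
have ImS (f : 'I_N -> R[i]) : complex.Im (\sum_k f k) = \sum_k complex.Im (f k).
  by apply: (big_morph _ _ (erefl _)) => -[a b] [c' d].
rewrite /coord /= !mxE; case: c => /=; rewrite ?ReS ?ImS; apply: eq_bigr => k _;
case: (X i k) => x x'; case: (Y k j) => y y' /=; by ring.
Qed.


End Coordinates.

(** Summing over the coordinates, rather than taking their maximum, makes the
    norm submultiplicative without a dimension factor. *)
HB.lock Definition nrm {R : realType} {N : nat} (M : 'M[R[i]]_N) : R :=
  \sum_k `|coord k M|.

Section Norm.
Context {R : realType} {N : nat}.
Local Notation mx := 'M[R[i]]_N.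
Implicit Types (M X Y : mx).

Lemma nrmE (M : mx) : nrm M = \sum_k `|coord k M|.
Proof. by rewrite unlock. Qed.

Lemma nrm_ge0 M : 0 <= nrm M.
Proof. by rewrite nrmE; apply: sumr_ge0. Qed.

Lemma coord_le_nrm k M : `|coord k M| <= nrm M.
Proof.
by rewrite !nrmE (bigD1 k)//= lerDl; apply: sumr_ge0.
Qed.

Lemma nrm0 : nrm (0 : mx) = 0.
Proof. by rewrite !nrmE big1// => k _; rewrite raddf0 normr0. Qed.

Lemma nrm0_eq0 M : nrm M = 0 -> M = 0.
Proof.
move=> h; apply: coord_inj => k; rewrite raddf0; apply/eqP.
by rewrite -normr_le0 -h coord_le_nrm.
Qed.

Lemma nrmN M : nrm (- M) = nrm M.
Proof. by rewrite !nrmE; apply: eq_bigr => k _; rewrite raddfN normrN. Qed.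

Lemma ler_nrmD X Y : nrm (X + Y) <= nrm X + nrm Y.
Proof.
by rewrite !nrmE -big_split; apply: ler_sum => k _; rewrite raddfD ler_normD.
Qed.

Lemma ler_nrmB X Y : nrm (X - Y) <= nrm X + nrm Y.
Proof. by rewrite -[nrm Y]nrmN ler_nrmD. Qed.

Lemma nrmZ (a : R) X : nrm (a *:r X) = `|a| * nrm X.
Proof.
by rewrite !nrmE mulr_sumr; apply: eq_bigr => k _; rewrite coordZ normrM.
Qed.

Lemma ler_nrmM X Y : nrm (X *m Y) <= nrm X * nrm Y.
Proof.
have sumE (f : cidx -> R) :
    \sum_k f k = \sum_i \sum_j (f (true, (i, j)) + f (false, (i, j))).
  transitivity (\sum_c \sum_ij f (c, ij)).
    by rewrite pair_bigA; apply: eq_bigr => -[].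
  rewrite big_bool/= -big_split/= pair_bigA.
  by apply: eq_bigr => -[].
pose x i k := `|coord (true, (i, k)) X| + `|coord (false, (i, k)) X|.
pose y i k := `|coord (true, (i, k)) Y| + `|coord (false, (i, k)) Y|.
have x0 i k : 0 <= x i k by rewrite addr_ge0.
have y0 i k : 0 <= y i k by rewrite addr_ge0.
have xyE i j : `|coord (true, (i, j)) (X *m Y)| + `|coord (false, (i, j)) (X *m Y)|
    <= \sum_k x i k * y k j.
  apply: (@le_trans _ _ (\sum_k
    (`|coord (true, (i, k)) X| * `|coord (false, (k, j)) Y| +
     `|coord (false, (i, k)) X| * `|coord (true, (k, j)) Y|) +
    \sum_k
    (`|coord (false, (i, k)) X| * `|coord (false, (k, j)) Y| +
     `|coord (true, (i, k)) X| * `|coord (true, (k, j)) Y|))).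
    by apply: lerD; rewrite coordM; apply: (le_trans (ler_norm_sum _ _ _));
      apply: ler_sum => k _; apply: (le_trans (ler_normD _ _));
      rewrite !normrM normrX ?normrN1 ?normr1 expr1n mul1r.
  by rewrite -big_split/=; apply: ler_sum => k _; rewrite /x /y; lra.
rewrite !nrmE !sumE.
apply: (@le_trans _ _ (\sum_i \sum_j \sum_k x i k * y k j)).
  by apply: ler_sum => i _; apply: ler_sum => j _; exact: xyE.
rewrite mulr_suml; apply: ler_sum => i _.
rewrite exchange_big/= mulr_suml; apply: ler_sum => k _.
rewrite -mulr_sumr -/(x i k); apply: ler_wpM2l => //.
rewrite [leRHS](bigD1 k)//= lerDl; apply: sumr_ge0 => i' _.
by apply: sumr_ge0 => j _; exact: y0.
Qed.

End Norm.

(** * Coordinatewise limits *)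

Lemma cvg_sumr {R : realType} {I : finType} {T} {F : set_system T} {FF : Filter F}
    (f : I -> T -> R) (l : I -> R) : (forall i, f i x @[x --> F] --> l i) ->
  \sum_i f i x @[x --> F] --> \sum_i l i.
Proof.
by move=> fl; apply: cvg_big => //; exact: add_continuous.
Qed.

Section GenericLimit.
Context {K : numFieldType} {N : nat}.

(** The limits of matrices are taken over an abstract numFieldType, which leaves
    the field structure of the complex numbers folded. *)
Definition mxlimn (u : nat -> 'M[K]_N) : 'M[K]_N := limn u.

Lemma mxlimnP (u : nat -> 'M[K]_N) (l : 'M[K]_N) :
  (forall e, 0 < e -> \forall n \near \oo, forall i j, `|l i j - u n i j| < e) ->
  mxlimn u = l.
Proof.
move=> ul; apply: cvg_lim; first exact: norm_hausdorff.
move=> A [P Pl sPA].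
suff : \forall n \near \oo, forall i j, P i j (u n i j).
  by apply: filterS => n Pn; exact: sPA.
apply: filter_forall => i; apply: filter_forall => j.
suff /(_ _ (Pl i j)) : u n i j @[n --> \oo] --> l i j by [].
apply/cvgrPdist_lt => e /ul; apply: filterS => n; exact.
Qed.

Definition mxseries (u : nat -> 'M[K]_N) n : 'M[K]_N := \sum_(0 <= k < n) u k.

Lemma mx0F1E (C : 'M[K]_N) (z : K) : mx0F1 C z =
  mxlimn (mxseries (fun k => (z ^+ k / k`!%:R) *: invmx (poch C k))).
Proof. by []. Qed.

Lemma mx1F2E (A B C : 'M[K]_N) (z : K) : mx1F2 A B C z =
  mxlimn (mxseries (fun k => (z ^+ k / k`!%:R) *:
    (poch A k *m invmx (poch B k) *m invmx (poch C k)))).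
Proof. by []. Qed.

End GenericLimit.

Section Limits.
Context {R : realType} {N : nat}.
Local Notation mx := 'M[R[i]]_N.

Definition mlim {T} (F : set_system T) (f : T -> mx) (l : mx) : Prop :=
  forall k, coord k (f x) @[x --> F] --> coord k l.

Section AnyFilter.
Context {T : Type} {F : set_system T} {FF : ProperFilter F}.
Implicit Types (f g : T -> mx) (l m : mx).

Lemma mlim_cst l : mlim F (fun=> l) l.
Proof. by move=> k; exact: cvg_cst. Qed.

Lemma eq_mlim f g l : (forall x, f x = g x) -> mlim F f l -> mlim F g l.
Proof. by move=> /funext <-. Qed.

Lemma mlimD f g l m : mlim F f l -> mlim F g m ->
  mlim F (fun x => f x + g x) (l + m).
Proof.
move=> fl gm k; rewrite raddfD/=.
under eq_fun do rewrite raddfD/=.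
exact: cvgD (fl k) (gm k).
Qed.

Lemma mlimN f l : mlim F f l -> mlim F (fun x => - f x) (- l).
Proof.
move=> fl k; rewrite raddfN/=.
under eq_fun do rewrite raddfN/=.
exact: cvgN (fl k).
Qed.

Lemma mlimB f g l m : mlim F f l -> mlim F g m ->
  mlim F (fun x => f x - g x) (l - m).
Proof. by move=> fl gm; apply: mlimD => //; exact: mlimN. Qed.

Lemma mlimM f g l m : mlim F f l -> mlim F g m ->
  mlim F (fun x => f x *m g x) (l *m m).
Proof.
move=> fl gm [c [i j]]; rewrite coordM.
under eq_fun do rewrite coordM.
apply: cvg_sumr => k; apply: cvgD.
  exact: cvgM.
by apply: cvgM => //; apply: cvgM => //; exact: cvg_cst.
Qed.

Lemma mlimMl X f l : mlim F f l -> mlim F (fun x => X *m f x) (X *m l).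
Proof. by move=> fl; apply: mlimM => //; exact: mlim_cst. Qed.

Lemma mlimMr X f l : mlim F f l -> mlim F (fun x => f x *m X) (l *m X).
Proof. by move=> fl; apply: mlimM => //; exact: mlim_cst. Qed.

Lemma mlimZ (a : T -> R) f (b : R) l : a x @[x --> F] --> b -> mlim F f l ->
  mlim F (fun x => (a x) *:r f x) (b *:r l).
Proof.
move=> ab fl k; rewrite coordZ.
under eq_fun do rewrite coordZ.
exact: cvgM.
Qed.

Lemma mlim_unique f l m : mlim F f l -> mlim F f m -> l = m.
Proof. by move=> fl fm; apply: coord_inj => k; apply: cvg_unique (fl k) (fm k). Qed.

Lemma cvg_nrm f l : mlim F f l -> nrm (f x) @[x --> F] --> nrm l.
Proof.
move=> fl; rewrite nrmE; under eq_fun do rewrite nrmE.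
by apply: cvg_sumr => k; apply: cvg_norm; exact: fl.
Qed.

Lemma mlim_nrm_le f l (c : R) : mlim F f l -> (\forall x \near F, nrm (f x) <= c) ->
  nrm l <= c.
Proof.
move=> fl fc.
have nl := cvg_nrm fl.
have /cvg_lim <- // := nl.
by apply: limr_le => //; apply/cvg_ex; exists (nrm l).
Qed.

Lemma mlim_squeeze f l (g : T -> R) : (\forall x \near F, nrm (f x - l) <= g x) ->
  g x @[x --> F] --> 0 -> mlim F f l.
Proof.
move=> fg g0 k; apply/cvgrPdist_le => e e0.
have /cvgrPdist_le/(_ _ e0) ge := g0.
near=> x.
rewrite distrC -raddfB (le_trans (coord_le_nrm _ _))//.
apply: (@le_trans _ _ (g x)); first by near: x.
by rewrite (le_trans (ler_norm _))// -normrN -sub0r; near: x.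
Unshelve. all: by end_near. Qed.

End AnyFilter.

(** Over the complex numbers a positive radius is real, and the modulus of an
    entry is at most the sum of its two coordinates. *)
Lemma mlim_limn (u : nat -> mx) l : mlim \oo u l -> mxlimn u = l.
Proof.
move=> ul; apply: mxlimnP => -[e e'].
rewrite ltcE/= => /andP[/eqP -> e0].
apply: filter_forall => i; apply: filter_forall => j.
have e20 : 0 < e / 2 by rewrite divr_gt0.
have /cvgrPdist_lt/(_ _ e20) := ul (false, (i, j)).
have /cvgrPdist_lt/(_ _ e20) := ul (true, (i, j)).
apply: filterS2 => n; rewrite /coord /=.
case: (l i j) => a b; case: (u n i j) => c d /= bd ac.
have -> : (a +i* b - (c +i* d)) = (a - c)%:C + (0 +i* (b - d)) :> R[i].
  by apply/eqP; rewrite eq_complex/= addr0 add0r !eqxx.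
rewrite (le_lt_trans (ler_normD _ _))// !normc_def/=.
rewrite expr0n/= addr0 add0r !sqrtr_sqr -rmorphD/= ltcE/= eqxx/=.
by lra.
Qed.

(** Each coordinate converges absolutely. *)
Lemma mseries_cvg (u : nat -> mx) (v : nat -> R) :
  (forall n, nrm (u n) <= v n) -> cvgn (series v) ->
  mlim \oo (mxseries u) (mxlimn (mxseries u)) /\
  forall k, coord k (mxlimn (mxseries u)) = limn (series (coord k \o u)).
Proof.
move=> uv cv.
have ck k : cvgn (series (coord k \o u)).
  apply: normed_cvg; apply: series_le_cvg cv => n //=.
    by rewrite (le_trans _ (uv n)) ?nrm_ge0.
  by rewrite (le_trans _ (uv n)) ?coord_le_nrm.
have sE k n : coord k (mxseries u n) = series (coord k \o u) n.
  by rewrite /mxseries/series/= raddf_sum.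
pose l : mx := \matrix_(i, j) (limn (series (coord (false, (i, j)) \o u))
                    +i* limn (series (coord (true, (i, j)) \o u))).
have lE k : coord k l = limn (series (coord k \o u)).
  by rewrite /coord /l !mxE; case: k => -[] [i j].
have ul : mlim \oo (mxseries u) l.
  by move=> k; under eq_fun do rewrite sE; rewrite lE; exact: ck.
by have ->  := mlim_limn ul.
Qed.

End Limits.

Arguments mlimMl {R N T F FF} X {f l} _.
Arguments mlimMr {R N T F FF} X {f l} _.

(** * Derivatives of matrix functions *)

Section Derivatives.
Context {R : realType}.

Lemma is_derive_cvg (f : R -> R) (x d : R) : is_derive x 1 f d ->
  f y @[y --> x] --> f x.
Proof.
by move=> [df _]; apply: differentiable_continuous; apply/derivable1_diffP.
Qed.

(** Both g - f and g + f have a nonnegative derivative. *)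
Lemma mean_value_dominated (f df g dg : R -> R) (a b : R) : a <= b ->
  (forall x, a <= x <= b -> is_derive x 1 f (df x)) ->
  (forall x, a <= x <= b -> is_derive x 1 g (dg x)) ->
  (forall x, a <= x <= b -> `|df x| <= dg x) ->
  `|f b - f a| <= g b - g a.
Proof.
move=> ab f' g' fg.
have oo x : x \in `]a, b[ -> a <= x <= b.
  by rewrite in_itv/= => /andP[/ltW -> /ltW ->].
have aux (h dh : R -> R) : (forall x, a <= x <= b -> is_derive x 1 h (dh x)) ->
    (forall x, a <= x <= b -> 0 <= dh x) -> h a <= h b.
  move=> h' h0.
  have [||c cab hE] := @MVT_segment R h dh a b ab.
  - by move=> x /oo; exact: h'.
  - apply: derivable_within_continuous => x; rewrite in_itv/= => /h' xh.
    exact: ex_derive.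
  - by rewrite -subr_ge0 hE mulr_ge0 ?subr_ge0//; apply: h0; rewrite in_itv in cab.
have H1 := aux (g \- f) (fun x => dg x - df x).
have H2 := aux (g \+ f) (fun x => dg x + df x).
have : g a - f a <= g b - f b.
  apply: H1 => x xab; first exact: is_deriveB (g' x xab) (f' x xab).
  by have := fg x xab; have := ler_norm (df x); lra.
have : g a + f a <= g b + f b.
  apply: H2 => x xab; first exact: is_deriveD (g' x xab) (f' x xab).
  by have := fg x xab; have := ler_norm (- df x); rewrite normrN; lra.
by rewrite ler_norml; lra.
Qed.

Context {N : nat}.
Local Notation mx := 'M[R[i]]_N.
Implicit Types (F G : R -> mx) (D E : mx).

Definition mder F (x : R) D : Prop :=
  forall k, is_derive x (1 : R) (fun t => coord k (F t)) (coord k D).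

Lemma mder_eq F x D E : mder F x D -> D = E -> mder F x E.
Proof. by move=> h <-. Qed.

Lemma mder_cvg F x D : mder F x D -> mlim (nbhs x) F (F x).
Proof. by move=> FD k; apply: is_derive_cvg (FD k). Qed.

Lemma mder_cst D x : mder (fun=> D) x 0.
Proof. by move=> k; rewrite raddf0; exact: is_derive_cst. Qed.

Lemma mderD F G x D E : mder F x D -> mder G x E ->
  mder (fun t => F t + G t) x (D + E).
Proof.
move=> FD GE k; rewrite raddfD/=.
rewrite (_ : (fun _ => _) = (fun t => coord k (F t)) + (fun t => coord k (G t))).
  exact: is_deriveD.
by apply/funext => t; rewrite raddfD.
Qed.

Lemma is_derive_mul (f g : R -> R) (x d e : R) :
  is_derive x 1 f d -> is_derive x 1 g e ->
  is_derive x 1 (fun t => f t * g t) (d * g x + f x * e).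
Proof.
move=> fd ge; have := is_deriveM fd ge.
by move/is_derive_eq; apply; rewrite /GRing.scale/= addrC mulrC.
Qed.

Lemma is_derive_sumr n (f : 'I_n -> R -> R) (x : R) (d : 'I_n -> R) :
  (forall i, is_derive x 1 (f i) (d i)) ->
  is_derive x 1 (fun t => \sum_i f i t) (\sum_i d i).
Proof.
move=> fd; have := @is_derive_sum _ _ _ n f x 1 d fd.
by rewrite fct_sumE.
Qed.

Lemma mderM F G x D E : mder F x D -> mder G x E ->
  mder (fun t => F t *m G t) x (D *m G x + F x *m E).
Proof.
move=> FD GE [c [i j]]; rewrite raddfD/= !coordM -big_split/=.
under eq_fun do rewrite coordM.
apply: is_derive_sumr => k.
have h1 := is_derive_mul (FD (c, (i, k))) (GE (false, (k, j))).
have h2 := is_derive_mul (is_derive_mul (is_derive_cst ((-1) ^+ (~~ c) : R) x 1)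
  (FD (~~ c, (i, k)))) (GE (true, (k, j))).
by apply: (is_derive_eq (is_deriveD h1 h2)) => /=; ring.
Qed.

Lemma mderZ (a : R -> R) F (x d : R) D : is_derive x 1 a d -> mder F x D ->
  mder (fun t => (a t) *:r F t) x (d *:r F x + (a x) *:r D).
Proof.
move=> ad FD k; rewrite raddfD/= !coordZ.
under eq_fun do rewrite coordZ.
exact: is_derive_mul.
Qed.

Lemma mderMr X F x D : mder F x D -> mder (fun t => F t *m X) x (D *m X).
Proof.
by move=> FD; apply: mder_eq (mderM FD (mder_cst X x)) _; rewrite mulmx0 addr0.
Qed.

Lemma mder_comp F (g : R -> R) (x d : R) D : is_derive x 1 g d ->
  mder F (g x) D -> mder (fun t => F (g t)) x (d *:r D).
Proof.
move=> gd FD k; rewrite coordZ mulrC.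
exact: is_derive1_comp (FD k) gd.
Qed.

Lemma mder0_cst F : (forall x, mder F x 0) -> forall x y, F x = F y.
Proof.
move=> F0 x y; apply: coord_inj => k.
apply: (@is_derive_0_is_cst _ (fun t => coord k (F t))) => t.
by have := F0 t k; rewrite raddf0.
Qed.

(** The dimension factor appears because the scalar inequality is applied to each
    coordinate separately. *)
Lemma mder_mean_value F dF (g dg : R -> R) (a b : R) : a <= b ->
  (forall x, a <= x <= b -> mder F x (dF x)) ->
  (forall x, a <= x <= b -> is_derive x 1 g (dg x)) ->
  (forall x, a <= x <= b -> nrm (dF x) <= dg x) ->
  nrm (F b - F a) <= #|{: @cidx N}|%:R * (g b - g a).
Proof.
move=> ab FD gD Fg.
rewrite nrmE mulr_natl -sumr_const; apply: ler_sum => k _; rewrite raddfB/=.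
apply: (@mean_value_dominated (coord k \o F) (coord k \o dF) g dg) => //.
  by move=> x xab; exact: FD.
by move=> x xab; rewrite (le_trans (coord_le_nrm _ _))//; exact: Fg.
Qed.

End Derivatives.

(** * The matrix exponential *)

Section Exponential.
Context {R : realType} {N : nat}.
Local Notation mx := 'M[R[i]]_N.
Implicit Types (X Y : mx).

Lemma mxpowerS X n : X ^+ n.+1 = X *m X ^+ n.
Proof. by rewrite exprS mulmxE. Qed.

Lemma expmxZ (s : R) X n : (s *:r X) ^+ n = (s ^+ n) *:r X ^+ n.
Proof.
elim: n => [|n IH]; first by rewrite !expr0 rscale1.
by rewrite !mxpowerS IH rscaleMl rscaleMr rscaleA exprS.
Qed.

Lemma ler_nrmX X n : nrm (X ^+ n) <= nrm (1%:M : mx) * nrm X ^+ n.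
Proof.
elim: n => [|n IH]; first by rewrite !expr0 mulr1.
rewrite mxpowerS (le_trans (ler_nrmM _ _))// exprS mulrCA ler_wpM2l//.
exact: nrm_ge0.
Qed.

Lemma expc_ge0 (x : R) n : 0 <= x -> 0 <= exp_coeff x n.
Proof. by move=> x0; rewrite /exp_coeff/= mulr_ge0 ?invr_ge0 ?exprn_ge0. Qed.

(** The coordinates of Y exp(s X) are power series in s. Carrying the left factor
    Y makes this family of series stable under differentiation. *)
Definition expcoef Y X (k : cidx) (n : nat) : R := coord k (Y *m X ^+ n) / n`!%:R.

Lemma expcoef_diffs Y X k :
  pseries_diffs (expcoef Y X k) = expcoef (Y *m X) X k.
Proof.
apply/funext => n; rewrite /pseries_diffs /expcoef mxpowerS mulmxA factS natrM.
rewrite invfM mulrCA; congr (_ * _).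
by rewrite mulrA divff ?mul1r// pnatr_eq0.
Qed.

Lemma expcoef_le Y X k n (s : R) : `|expcoef Y X k n * s ^+ n| <=
  nrm Y * nrm (1%:M : mx) * exp_coeff (nrm X * `|s|) n.
Proof.
rewrite /expcoef /exp_coeff/= normrM normrM normrV ?unitfE ?pnatr_eq0 -?lt0n ?fact_gt0//.
rewrite normr_nat normrX mulrAC -!mulrA !mulrA exprMn !mulrA.
rewrite ler_wpM2r ?invr_ge0// ler_wpM2r ?exprn_ge0//.
rewrite (le_trans (coord_le_nrm _ _))// (le_trans (ler_nrmM _ _))// -mulrA.
by rewrite ler_wpM2l ?nrm_ge0 ?ler_nrmX.
Qed.

Lemma expcoef_cvg Y X k s : cvgn (pseries (expcoef Y X k) s).
Proof.
apply: normed_cvg.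
apply: (@series_le_cvg _ _
  (nrm Y * nrm (1%:M : mx) *: exp_coeff (nrm X * `|s|))).
- by move=> n /=.
- move=> n; apply: mulr_ge0; first by rewrite mulr_ge0 ?nrm_ge0.
  by apply: expc_ge0; rewrite mulr_ge0 ?nrm_ge0.
- by move=> n; exact: expcoef_le.
- exact/is_cvg_seriesZ/is_cvg_series_exp_coeff.
Qed.

Lemma mxexp_term (s : R) X n :
  (n`!%:R : R[i])^-1 *: (s *:r X) ^+ n = (s ^+ n / n`!%:R) *:r X ^+ n.
Proof.
rewrite expmxZ !rscaleE scalerA mulrC rmorphM/= rmorphV ?rmorph_nat//.
by rewrite unitfE pnatr_eq0 -lt0n fact_gt0.
Qed.

Definition mxexp_seq X n : mx := (n`!%:R : R[i])^-1 *: X ^+ n.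

(** Both the matrix exponential and 0F1 are dominated by a scalar exponential. *)
Lemma exp_dominated_series (u : nat -> mx) (c x : R) : 0 <= c -> 0 <= x ->
  (forall n, nrm (u n) <= c * exp_coeff x n) ->
  mlim \oo (mxseries u) (mxlimn (mxseries u)) /\
  forall n, nrm (mxseries u n) <= c * expR x.
Proof.
move=> c0 x0 ux.
have [|cu _] := @mseries_cvg _ _ u (c *: exp_coeff x) ux.
  exact/is_cvg_seriesZ/is_cvg_series_exp_coeff.
split => // n.
apply: (@le_trans _ _ (\sum_(0 <= k < n) nrm (u k))).
  rewrite /mxseries; elim/big_ind2 : _ => //; first by rewrite nrm0.
  by move=> A a B b Aa Bb; rewrite (le_trans (ler_nrmD _ _))// lerD.
apply: (@le_trans _ _ (\sum_(0 <= k < n) c * exp_coeff x k)).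
  by apply: ler_sum => k _.
rewrite -mulr_sumr ler_wpM2l// /expR.
apply: (@nondecreasing_cvgn_le _ (series (exp_coeff x))).
  by apply/nondecreasing_series => k _ _; exact: expc_ge0.
exact: is_cvg_series_exp_coeff.
Qed.

Lemma mxexp_cvg X : mlim \oo (mxseries (mxexp_seq X)) (mxexp X) /\
  nrm (mxexp X) <= nrm (1%:M : mx) * expR (nrm X).
Proof.
have le n : nrm (mxexp_seq X n) <= nrm (1%:M : mx) * exp_coeff (nrm X) n.
  rewrite /mxexp_seq -[X]rscale1 mxexp_term nrmZ expr1n mul1r rscale1.
  rewrite ger0_norm ?invr_ge0// mulrC mulrA.
  by rewrite ler_wpM2r ?invr_ge0// ler_nrmX.
have [cX bX] := exp_dominated_series (nrm_ge0 _) (nrm_ge0 _) le.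
by split => //; apply: (mlim_nrm_le cX); apply: nearW.
Qed.

Lemma nrm_mxexp X : nrm (mxexp X) <= nrm (1%:M : mx) * expR (nrm X).
Proof. exact: (mxexp_cvg X).2. Qed.

Lemma coord_mxexp Y X k (s : R) :
  coord k (Y *m mxexp (s *:r X)) = limn (pseries (expcoef Y X k) s).
Proof.
have [cX _] := mxexp_cvg (s *:r X).
apply/esym/cvg_lim => //.
have cYX : mlim \oo (fun n => Y *m mxseries (mxexp_seq (s *:r X)) n)
  (Y *m mxexp (s *:r X)) by exact: mlimMl.
move: (cYX k); apply: cvg_trans; apply: near_eq_cvg; apply: nearW => n.
rewrite /mxseries /pseries /series/= mulmx_sumr raddf_sum/=.
apply: eq_bigr => j _.
by rewrite /mxexp_seq mxexp_term rscaleMr coordZ /expcoef; ring.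
Qed.

Lemma mder_mxexpZ X (s : R) :
  mder (fun t => mxexp (t *:r X)) s (X *m mxexp (s *:r X)).
Proof.
move=> k.
rewrite (_ : (fun _ => _) = (fun t => limn (pseries (expcoef 1%:M X k) t))); last first.
  by apply/funext => t; rewrite -coord_mxexp mul1mx.
rewrite coord_mxexp.
have -> : expcoef X X k = pseries_diffs (expcoef 1%:M X k).
  by rewrite expcoef_diffs mul1mx.
(* The radius of convergence is infinite; any point beyond |s| serves. *)
apply: (@pseries_snd_diffs _ _ (`|s| + 1)); rewrite ?expcoef_diffs.
- exact: expcoef_cvg.
- exact: expcoef_cvg.
- exact: expcoef_cvg.
- by rewrite [ltRHS]ger0_norm ?addr_ge0// ltrDl.
Qed.

Lemma mxexp0 : mxexp (0 : mx) = 1%:M.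
Proof.
have [c0 _] := mxexp_cvg 0.
apply: (mlim_unique c0).
move=> k; apply: cvg_near_cst; exists 1%N => // -[//|n] _.
rewrite /mxseries big_ltn// big1_seq ?addr0; last first.
  move=> i; rewrite mem_index_iota => /andP[_ /andP[i0 _]].
  by rewrite /mxexp_seq expr0n; case: i i0 => // i _; rewrite scaler0.
by rewrite /mxexp_seq expr0 fact0 invr1 scale1r.
Qed.

Lemma comm_mxexp X Y : comm_mx X Y -> comm_mx X (mxexp Y).
Proof.
move=> XY; have [cY _] := mxexp_cvg Y.
apply: (mlim_unique (mlimMl X cY)).
apply: eq_mlim (mlimMr X cY) => n.
rewrite /mxseries mulmx_sumr mulmx_suml; apply: eq_bigr => k _.
rewrite /mxexp_seq -scalemxAl -scalemxAr; congr (_ *: _).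
elim: k => [|k IH]; first by rewrite expr0 mulmx1 mul1mx.
by rewrite mxpowerS mulmxA XY -!mulmxA IH.
Qed.

Lemma mxexpZ0 X : mxexp (0 *:r X) = 1%:M.
Proof. by rewrite rscale0 mxexp0. Qed.

Lemma comm_mxexpZ X Y (s : R) : comm_mx X Y -> comm_mx X (mxexp (s *:r Y)).
Proof.
by move=> XY; apply: comm_mxexp; rewrite /comm_mx rscaleMl rscaleMr XY.
Qed.

(** The derivatives of the two factors cancel, M commuting with its exponential. *)
Lemma mxexp_ode_const M (F : R -> mx) : (forall s, mder F s (M *m F s)) ->
  forall s, mxexp ((- s) *:r M) *m F s = F 0.
Proof.
move=> FM s.
rewrite (@mder0_cst _ _ (fun s => mxexp ((- s) *:r M) *m F s) _ s 0).
  by rewrite oppr0 mxexpZ0 mul1mx.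
move=> x.
have nx : is_derive x (1 : R) -%R (- 1 : R) by exact: is_deriveNid.
apply: mder_eq (mderM (mder_comp nx (mder_mxexpZ M _)) (FM x)) _.
rewrite rscaleNr rscale1 mulNmx mulmxA.
by rewrite (comm_mxexpZ _ (erefl : comm_mx M M)) addNr.
Qed.

Lemma mxexpZNK X (s : R) : mxexp ((- s) *:r X) *m mxexp (s *:r X) = 1%:M.
Proof.
by rewrite (mxexp_ode_const (mder_mxexpZ X)) mxexpZ0.
Qed.

Lemma mxexp_ode M (F : R -> mx) : (forall s, mder F s (M *m F s)) ->
  forall s, F s = mxexp (s *:r M) *m F 0.
Proof.
move=> FM s; rewrite -(mxexp_ode_const FM s) mulmxA.
by have := mxexpZNK M (- s); rewrite opprK => ->; rewrite mul1mx.
Qed.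

(** Both sides solve F' = (X + Y) F with the same initial value. *)
Lemma mxexpZD X Y (s : R) : comm_mx X Y ->
  mxexp (s *:r (X + Y)) = mxexp (s *:r X) *m mxexp (s *:r Y).
Proof.
move=> XY.
rewrite (@mxexp_ode (X + Y) (fun s => mxexp (s *:r X) *m mxexp (s *:r Y))).
  by rewrite !mxexpZ0 !mulmx1.
move=> x; apply: mder_eq (mderM (mder_mxexpZ X x) (mder_mxexpZ Y x)) _.
rewrite mulmxDl !mulmxA; congr (_ + _ *m _).
by rewrite (comm_mxexpZ x (esym XY : comm_mx Y X)).
Qed.

Lemma mxexpZDl X (s t : R) :
  mxexp ((s + t) *:r X) = mxexp (s *:r X) *m mxexp (t *:r X).
Proof.
have c : comm_mx (s *:r X) (t *:r X).
  by rewrite /comm_mx !rscaleMl !rscaleMr !rscaleA mulrC.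
have := mxexpZD 1 c; rewrite !rscale1 => <-.
by rewrite rscaleDl.
Qed.

Lemma eqler (x y : R) : x = y -> x <= y.
Proof. by move=> ->. Qed.

Lemma is_derive_mulr (x s : R) : is_derive s 1 (fun t : R => t * x) x.
Proof.
apply: is_derive_eq (is_derive_mul (is_derive_id s 1) (is_derive_cst x s 1)) _.
by rewrite /cst mul1r mulr0 addr0.
Qed.

Lemma is_derive_expRZ (x s : R) :
  is_derive s 1 (fun t : R => expR (t * x)) (x * expR (s * x)).
Proof.
rewrite mulrC.
exact: (@is_derive1_comp _ expR (fun t : R => t * x)) (is_derive_mulr x s).
Qed.

Lemma mxexp_realscalar (s x : R) :
  mxexp (s *:r (x%:C)%:M) = (expR (s * x)) *:r 1%:M :> mx.
Proof.
have /= -> := @mxexp_ode (x%:C%:M) (fun s => (expR (s * x)) *:r 1%:M : mx) _ s.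
  by rewrite mul0r expR0 rscale1 mulmx1.
move=> t; apply: mder_eq (mderZ (is_derive_expRZ x t) (mder_cst _ _)) _.
by rewrite rscaler0 addr0 rscaleMr mulmx1 -[(x%:C)%:M]scalemx1 -rscaleE rscaleA mulrC.
Qed.

(** This exponential is the rotation cos(s y) + i sin(s y), which solves the same
    differential equation. *)
Lemma nrm_mxexp_imscalar (y : R) : exists2 c : R, 0 <= c &
  forall s : R, nrm (mxexp (s *:r (0 +i* y)%:M) : mx) <= c.
Proof.
pose J : mx := (0 +i* 1)%:M.
pose F (s : R) : mx := (cos (s * y)) *:r 1%:M + (sin (s * y)) *:r J.
exists (nrm (1%:M : mx) + nrm J); first by rewrite addr_ge0 ?nrm_ge0.
move=> s.
have FE : F s = mxexp (s *:r (0 +i* y)%:M).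
  rewrite (@mxexp_ode (0 +i* y)%:M F).
    by rewrite /F mul0r cos0 sin0 rscale1 rscale0 addr0 mulmx1.
  move=> t.
  have hc : is_derive t 1 (fun s : R => cos (s * y)) (- sin (t * y) * y).
    exact: (@is_derive1_comp _ cos (fun s : R => s * y)) (is_derive_mulr y t).
  have hs : is_derive t 1 (fun s : R => sin (s * y)) (cos (t * y) * y).
    exact: (@is_derive1_comp _ sin (fun s : R => s * y)) (is_derive_mulr y t).
  apply: mder_eq (mderD (mderZ hc (mder_cst _ _)) (mderZ hs (mder_cst _ _))) _.
  rewrite !rscaler0 !addr0 /F /J !rscaleE.
  rewrite -[_%:M in RHS]scalemx1 -[(0 +i* 1)%:M]scalemx1.
  rewrite -scalemxAl mul1mx scalerDr !scalerA -!scalerDl.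
  congr (_ *: _); apply/eqP; rewrite eq_complex/=; apply/andP.
  by split; apply/eqP; ring.
rewrite -FE /F (le_trans (ler_nrmD _ _))// !nrmZ.
apply: lerD; rewrite -[leRHS]mul1r ler_wpM2r ?nrm_ge0// ler_norml.
  by rewrite cos_geN1 cos_le1.
by rewrite sin_geN1 sin_le1.
Qed.

Lemma nrm_mxexp_scalar (a : R[i]) : exists2 c : R, 0 <= c &
  forall s : R, nrm (mxexp (s *:r a%:M) : mx) <= c * expR (s * complex.Re a).
Proof.
case: a => x y; have [c c0 cP] := nrm_mxexp_imscalar y.
exists c => // s /=.
have -> : (x +i* y)%:M = x%:C%:M + (0 +i* y)%:M :> mx.
  by rewrite -raddfD/=; congr (_%:M); apply/eqP; rewrite eq_complex/= addr0 add0r !eqxx.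
rewrite mxexpZD ?mxexp_realscalar; last exact/comm_mx_scalar.
rewrite rscaleMl mul1mx nrmZ ger0_norm ?expR_ge0// mulrC.
by rewrite ler_wpM2r ?expR_ge0.
Qed.

(** Induction on the factors X - a annihilating Y. The function
    g(s) = exp(s (a - X)) Y has derivative - exp(s (a - X)) (X - a) Y, where
    (X - a) Y is annihilated by one factor less. Its exponential bound therefore
    integrates to one for g. *)
Lemma mxexp_decay_factors (X : mx) (alpha : R) (rs : seq R[i]) : forall Y : mx,
  (forall a, a \in rs -> alpha < complex.Re a) ->
  foldl (fun Z a => (X - a%:M) *m Z) Y rs = 0 ->
  exists2 c : R, 0 <= c &
  forall s, 0 <= s -> nrm (mxexp (s *:r - X) *m Y) <= c * expR (- (s * alpha)).
Proof.
elim: rs => [|a rs IH] Y ars /= Y0.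
  by exists 0 => // s s0; rewrite Y0 mulmx0 nrm0 mul0r.
have [|c c0 cP] := IH _ _ Y0.
  by move=> b brs; apply: ars; rewrite inE brs orbT.
have [d d0 dP] := nrm_mxexp_scalar a.
have [e e0 eP] := nrm_mxexp_scalar (- a).
set x := complex.Re a in dP *; have ax : alpha < x by apply: ars; rewrite mem_head.
have b0 : 0 < x - alpha by rewrite subr_gt0.
have ReN : complex.Re (- a) = - x by rewrite /x; case: (a).
pose Z : mx := a%:M - X.
pose n : R := #|{: @cidx N}|%:R.
have n0 : 0 <= n by [].
have scalC (b : R[i]) (T : mx) : comm_mx b%:M T by exact: comm_scalar_mx.
have g' s : 0 <= s -> nrm (mxexp (s *:r Z) *m (Z *m Y)) <=
    (d * c / (x - alpha)) * ((x - alpha) * expR (s * (x - alpha))).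
  move=> s0; rewrite -[Z]opprK opprB mulNmx mulmxN nrmN.
  rewrite opprB mxexpZD; last by apply/scalC.
  rewrite -mulmxA (le_trans (ler_nrmM _ _))//.
  apply: (@le_trans _ _ ((d * expR (s * x)) * (c * expR (- (s * alpha))))).
    by apply: ler_pM; rewrite ?nrm_ge0 ?dP ?cP.
  rewrite mulrBr expRD; apply: eqler; field.
  by rewrite gt_eqF.
have gE s : 0 <= s -> nrm (mxexp (s *:r Z) *m Y) <=
    (nrm Y + n * (d * c / (x - alpha))) * expR (s * (x - alpha)).
  move=> s0.
  pose k := d * c / (x - alpha).
  have {g'} mv : nrm (mxexp (s *:r Z) *m Y - mxexp (0 *:r Z) *m Y) <=
      n * (k * expR (s * (x - alpha)) - k * expR (0 * (x - alpha))).
    apply: (@mder_mean_value _ _ (fun s => mxexp (s *:r Z) *m Y)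
      (fun s => mxexp (s *:r Z) *m (Z *m Y)) (fun s => k * expR (s * (x - alpha)))
      (fun s => k * ((x - alpha) * expR (s * (x - alpha))))) => // t /andP[t0 _].
    - apply: mder_eq (mderMr Y (mder_mxexpZ Z t)) _.
      by rewrite (comm_mxexpZ t (erefl : comm_mx Z Z)) mulmxA.
    - have := is_derive_mul (is_derive_cst k t 1) (is_derive_expRZ (x - alpha) t).
      by move/is_derive_eq; apply; rewrite mul0r add0r.
    - exact: g'.
  rewrite mxexpZ0 mul1mx mul0r expR0 mulr1 in mv.
  have E1 : 1 <= expR (s * (x - alpha)).
    by rewrite -expR0 ler_expR mulr_ge0// ltW.
  have k0 : 0 <= k by rewrite /k divr_ge0 ?mulr_ge0// ltW.
  rewrite -/k -[_ *m Y](subrK Y) (le_trans (ler_nrmD _ _))// mulrDl addrC lerD//.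
    by rewrite ler_peMr ?nrm_ge0.
  rewrite (le_trans mv)// -mulrA ler_wpM2l// lerBlDr lerDl.
  exact: k0.
exists (e * (nrm Y + n * (d * c / (x - alpha)))).
  by rewrite mulr_ge0// addr_ge0 ?nrm_ge0// mulr_ge0// divr_ge0 ?mulr_ge0// ltW.
move=> s s0.
have -> : - X = (- a)%:M + Z by rewrite /Z raddfN addKr.
rewrite mxexpZD; last exact/scalC.
rewrite -mulmxA (le_trans (ler_nrmM _ _))//.
apply: (@le_trans _ _ ((e * expR (- (s * x))) *
  ((nrm Y + n * (d * c / (x - alpha))) * expR (s * (x - alpha))))).
  by apply: ler_pM; rewrite ?nrm_ge0 ?gE// -mulrN -ReN eP.
have -> : - (s * alpha) = - (s * x) + s * (x - alpha) by ring.
by rewrite expRD; apply: eqler; ring.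
Qed.

End Exponential.

(** * Powers of a positive real number *)

(** Locked, so that comparing two powers never unfolds the limit that defines the
    exponential. *)
HB.lock Definition mpow {R : realType} {N : nat} (t : R) (M : 'M[R[i]]_N) : 'M[R[i]]_N :=
  mxpow t M.

Section Powers.
Context {R : realType}.

(** Cayley-Hamilton, with the characteristic polynomial split over its roots. *)
Lemma annihilating_factors N (X : 'M[R[i]]_N.+1) : exists2 rs : seq R[i],
  (forall a, a \in rs -> eigenvalue X a) &
  forall Y : 'M[R[i]]_N.+1, foldl (fun Z a => (X - a%:M) *m Z) Y rs = 0.
Proof.
have [rs rsE] := closed_field_poly_normal (char_poly X).
rewrite (monicP (char_poly_monic X)) scale1r in rsE.
exists rs => [a ars|Y].
  by rewrite eigenvalue_root_char rsE root_prod_XsubC.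
have -> : foldl (fun Z a => (X - a%:M) *m Z) Y rs =
    horner_mx X (\prod_(a <- rs) ('X - a%:P)) *m Y.
  elim: rs {rsE} Y => [|a rs IH] Y /=.
    by rewrite big_nil rmorph1 mul1mx.
  rewrite IH big_cons mulrC rmorphM/= -mulmxE mulmxA; congr (_ *m _ *m _).
  by rewrite rmorphB/= horner_mx_X horner_mx_C.
by rewrite -rsE Cayley_Hamilton mul0mx.
Qed.

Lemma pos_lower_bound (rs : seq R[i]) :
  (forall a, a \in rs -> 0 < complex.Re a) ->
  exists2 alpha : R, 0 < alpha & forall a, a \in rs -> alpha < complex.Re a.
Proof.
elim: rs => [|a rs IH] ars; first by exists 1.
have [|al al0 alP] := IH; first by move=> b brs; apply: ars; rewrite inE brs orbT.
have a0 : 0 < complex.Re a by apply: ars; rewrite mem_head.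
exists (Num.min al (complex.Re a / 2)); first by rewrite lt_min al0 divr_gt0.
move=> b; rewrite inE gt_min => /predU1P[->|/alP -> //].
by apply/orP; right; lra.
Qed.

Context {N : nat}.
Local Notation mx := 'M[R[i]]_N.
Implicit Types (X Y M : mx) (s t : R).

Lemma mxexp_decay M : positive_stable M -> exists2 alpha : R, 0 < alpha &
  exists2 c : R, 0 <= c &
  forall s, 0 <= s -> nrm (mxexp (s *:r - M)) <= c * expR (- (s * alpha)).
Proof.
case: N M => [|n] M psM.
  exists 1 => //; exists 0 => // s s0.
  by rewrite [mxexp _]thinmx0 nrm0 mul0r.
have [rs rsM rs0] := annihilating_factors M.
have [al al0 alP] := pos_lower_bound (fun a ars => psM a (rsM a ars)).
exists al => //.
have [c c0 cP] := mxexp_decay_factors alP (rs0 1%:M).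
by exists c => // s s0; rewrite -[mxexp _]mulmx1 cP.
Qed.

Lemma mpowE t M : mpow t M = mxexp (ln t *:r M).
Proof. by rewrite rscaleE mpow.unlock. Qed.

(** Substitute t = exp(- s) in the decay of exp(- s M). *)
Lemma mpow_decay M : positive_stable M -> exists2 alpha : R, 0 < alpha &
  exists2 c : R, 0 <= c &
  forall t, 0 < t <= 1 -> nrm (mpow t M) <= c * t `^ alpha.
Proof.
move=> /mxexp_decay[al al0 [c c0 cP]]; exists al => //; exists c => // t /andP[t0 t1].
have := cP (- ln t).
rewrite oppr_ge0 ln_le0// => /(_ isT); rewrite rscalerN -rscaleNr opprK.
by rewrite mpowE mulNr opprK mulrC /powR gt_eqF// mulrC [al * _]mulrC.
Qed.

Lemma nrm_mpow t M : nrm (mpow t M) <= nrm (1%:M : mx) * expR (`|ln t| * nrm M).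
Proof. by rewrite -nrmZ mpowE; exact: nrm_mxexp. Qed.

Lemma mpowD t X Y : comm_mx X Y -> mpow t (X + Y) = mpow t X *m mpow t Y.
Proof. by move=> XY; rewrite !mpowE mxexpZD. Qed.

Lemma mpowM s t X : 0 < s -> 0 < t -> mpow (s * t) X = mpow s X *m mpow t X.
Proof. by move=> s0 t0; rewrite !mpowE lnM ?posrE// mxexpZDl. Qed.

Lemma mpow1 X : mpow 1 X = 1%:M.
Proof. by rewrite mpowE ln1 mxexpZ0. Qed.

Lemma mpow0 t : mpow t (0 : mx) = 1%:M.
Proof. by rewrite mpowE rscaler0 mxexp0. Qed.

Lemma comm_mpow t X Y : comm_mx X Y -> comm_mx X (mpow t Y).
Proof. by move=> XY; rewrite mpowE; exact: comm_mxexpZ. Qed.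

Lemma mpow_scalar t (a : R) : 0 < t -> mpow t a%:C%:M = (t `^ a : R) *:r 1%:M :> mx.
Proof.
by move=> t0; rewrite mpowE mxexp_realscalar /powR gt_eqF// mulrC.
Qed.

Lemma mpow_nat t (k : nat) : 0 < t -> mpow t (k%:R)%:M = (t ^+ k : R) *:r 1%:M :> mx.
Proof.
move=> t0; have -> : k%:R = (k%:R)%:C :> R[i] by rewrite rmorph_nat.
by rewrite mpow_scalar// powR_mulrn// ltW.
Qed.

Lemma mpowDnat t X (k : nat) : 0 < t ->
  mpow t (X + (k%:R)%:M) = (t ^+ k : R) *:r mpow t X.
Proof.
move=> t0; rewrite mpowD; last exact: comm_mx_scalar.
by rewrite mpow_nat// rscaleMr mulmx1.
Qed.

Lemma mpowB1 t X : 0 < t -> mpow t (X - 1%:M) = (t^-1 : R) *:r mpow t X.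
Proof.
move=> t0; rewrite -[in RHS](subrK 1%:M X) (mpowDnat (X - 1%:M) 1)// expr1.
by rewrite rscaleA mulVf ?gt_eqF// rscale1.
Qed.

Lemma mpowN t X : mpow t X *m mpow t (- X) = 1%:M.
Proof.
rewrite -mpowD; first by rewrite subrr mpow0.
by rewrite /comm_mx mulmxN mulNmx.
Qed.

Lemma mder_mpow t X : 0 < t ->
  mder (fun t => mpow t X) t (X *m mpow t (X - 1%:M)).
Proof.
move=> t0.
have lnt : is_derive t 1 (@ln R) t^-1 by exact: is_derive1_ln.
rewrite (_ : (fun _ => _) = (fun t => mxexp (ln t *:r X))); last first.
  by apply/funext => s; rewrite mpowE.
apply: mder_eq (mder_comp lnt (mder_mxexpZ X _)) _.
by rewrite mpowB1// rscaleMr mpowE.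
Qed.

Lemma mder_mpow1B t X : t < 1 ->
  mder (fun t => mpow (1 - t) X) t (- (X *m mpow (1 - t) (X - 1%:M))).
Proof.
rewrite -subr_gt0 => t1.
have h : is_derive t 1 (fun t : R => 1 - t) (- 1 : R).
  have := is_deriveB (is_derive_cst (1 : R) t 1) (is_derive_id t 1).
  by move/is_derive_eq; apply; rewrite sub0r.
apply: mder_eq (mder_comp h (mder_mpow X t1)) _.
by rewrite rscaleNr rscale1.
Qed.

Lemma positive_stable_addn X (k : nat) :
  positive_stable X -> positive_stable (X + (k%:R)%:M).
Proof.
move=> psX a /eigenvalueP[v vX v0].
have : eigenvalue X (a - k%:R).
  apply/eigenvalueP; exists v => //.
  by rewrite scalerBl -vX mulmxDr mul_mx_scalar addrK.
move/psX; rewrite -[k%:R](rmorph_nat (real_complex R)) => h.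
have kk : 0 <= k%:R :> R by [].
move: h; case: a {vX} => x y /= => h; lra.
Qed.

Lemma positive_stable_unit X : positive_stable X -> X \in unitmx.
Proof.
move=> psX; rewrite -row_free_unit -kermx_eq0; apply/negPn/negP => /rowV0Pn[v].
move=> /sub_kermxP vX v0.
have /psX : eigenvalue X 0 by apply/eigenvalueP; exists v => //; rewrite vX scale0r.
by rewrite ltxx.
Qed.

Lemma addn_unit X (k : nat) : positive_stable X -> X + (k%:R)%:M \in unitmx.
Proof. by move=> psX; apply/positive_stable_unit/positive_stable_addn. Qed.

End Powers.

(** * Improper integrals by exhaustion *)

Section Improper.
Context {R : realType}.
Local Notation mu := (@lebesgue_measure R).

(** An exhaustion of D by segments, along which improper integrals over D are
    limits of proper ones. *)
Definition exhausts (D : set R) (a b : nat -> R) : Prop :=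
  [/\ measurable D, forall n, a n < b n,
      forall n, `[a n, b n] `<=` D
    & forall x, D x -> \forall n \near \oo, x \in `[a n, b n] ].

(** Dominated convergence for the restrictions of f to the segments. *)
Lemma exhausts_cvg D a b (f : R -> R) : exhausts D a b ->
  mu.-integrable D (EFin \o f) ->
  \int[mu]_(x in `[a n, b n]) f x @[n --> \oo] --> \int[mu]_(x in D) f x.
Proof.
move=> [mD ab abD Dab] fint.
pose g n : R -> \bar R := ((EFin \o f) \_ `[a n, b n])%E.
have gE n : (\int[mu]_(x in `[a n, b n]) (f x)%:E = \int[mu]_(x in D) g n x)%E.
  by rewrite /g -integral_mkcondr (setIidr (@abD n)).
have fm := measurable_int _ fint.
have H n : measurable_fun D (g n).
  apply/measurable_restrict => //.
  by apply: measurable_funS fm => // x [].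
have H2 x : D x -> g n x @[n --> \oo] --> (EFin \o f) x.
  move=> Dx; apply: cvg_near_cst.
  by apply: filterS (Dab x Dx) => n xn; rewrite /g patchE mem_setE xn.
have H5 n x : D x -> (`|g n x| <= (abse \o (EFin \o f)) x)%E.
  by move=> Dx; rewrite /g patchE; case: ifP => //= _; rewrite normr0 lee_fin.
have H3 x : D x -> (abse \o (EFin \o f)) x \is a fin_num by [].
have H4 : mu.-integrable D (abse \o (EFin \o f)) by exact: integrable_abse.
have := @dominated_cvg _ _ R mu D mD _ _ _ H H2 H3 H4 H5.
rewrite -(@fineK _ (\int[mu]_(x in D) _)%E); last exact: integrable_fin_num.
move=> /fine_cvg; apply: cvg_trans; apply: near_eq_cvg; apply: nearW => n.
by rewrite /Rintegral gE.
Qed.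

Lemma continuous_within_pt (f : R -> R) (a b : R) :
  (forall x, x \in `[a, b] -> {for x, continuous f}) -> {within `[a, b], continuous f}.
Proof.
move=> fc; apply: continuous_in_subspaceT => x xab; apply: fc.
by rewrite inE in xab.
Qed.

Lemma Rintegral_FTC (f F : R -> R) (a b : R) : a < b ->
  (forall x, x \in `[a, b] -> {for x, continuous f}) ->
  (forall x, x \in `[a, b] -> is_derive x 1 F (f x)) ->
  (\int[mu]_(x in `[a, b]) (f x)%:E = (F b - F a)%:E)%E.
Proof.
move=> ab fc Ff.
have oo x : x \in `]a, b[ -> x \in `[a, b] by exact: subset_itv_oo_cc.
rewrite (@continuous_FTC2 _ f F)//.
- exact: continuous_within_pt.
- split.
  + by move=> x /oo /Ff h; exact: ex_derive.
  + apply: cvg_at_right_filter; apply: is_derive_cvg; apply: Ff.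
    by rewrite in_itv/= lexx ltW.
  + apply: cvg_at_left_filter; apply: is_derive_cvg; apply: Ff.
    by rewrite in_itv/= lexx ltW.
- by move=> x /oo /Ff h; rewrite derive1E derive_val.
Qed.

Lemma measurable_exhausts D a b (f : R -> R) : open D -> exhausts D a b ->
  (forall x, D x -> {for x, continuous f}) -> measurable_fun D f.
Proof.
move=> oD [mD _ _ _] fc; apply: open_continuous_measurable_fun => //.
by move=> x; rewrite inE => /fc.
Qed.

(** Unlike on a segment, f may be unbounded near the ends of D. *)
Lemma integral_FTC_open D a b (f F : R -> R) (l : R) : exhausts D a b ->
  (forall x, D x -> {for x, continuous f}) ->
  (forall x, D x -> is_derive x 1 F (f x)) ->
  mu.-integrable D (EFin \o f) ->
  F (b n) - F (a n) @[n --> \oo] --> l ->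
  \int[mu]_(x in D) f x = l.
Proof.
move=> exD fc Ff fint Fl; have [mD ab abD Dab] := exD.
have h := exhausts_cvg exD fint.
apply: (cvg_unique _ h) => //.
apply: cvg_trans Fl; apply: near_eq_cvg; apply: nearW => n.
by rewrite /Rintegral (Rintegral_FTC (ab n) (fun x xn => fc x (abD n x xn))
  (fun x xn => Ff x (abD n x xn))).
Qed.

(** By Fatou's lemma, a bounded primitive suffices for integrability. *)
Lemma integrable_FTC_open D a b (f F : R -> R) (C : R) : open D -> exhausts D a b ->
  (forall x, D x -> {for x, continuous f}) ->
  (forall x, D x -> 0 <= f x) ->
  (forall x, D x -> is_derive x 1 F (f x)) ->
  (forall n, F (b n) - F (a n) <= C) ->
  mu.-integrable D (EFin \o f).
Proof.
move=> oD exD fc f0 Ff FC; have [mD ab abD Dab] := exD.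
have /measurable_EFinP fm := measurable_exhausts oD exD fc.
apply/integrableP; split => //.
rewrite (@eq_integral _ _ R mu D (EFin \o f)); last first.
  by move=> x; rewrite inE => Dx /=; rewrite ger0_norm ?f0.
pose g n : R -> \bar R := ((EFin \o f) \_ `[a n, b n])%E.
have H n : measurable_fun D (g n).
  apply/measurable_restrict => //.
  by apply: measurable_funS fm => // x [].
have g0 n x : D x -> (0 <= g n x)%E.
  by move=> Dx; rewrite /g patchE; case: ifP => // _; rewrite lee_fin f0.
have gC n : (\int[mu]_(x in D) g n x <= C%:E)%E.
  rewrite /g -integral_mkcondr (setIidr (@abD n)) 
    (Rintegral_FTC (ab n) (fun x xn => fc x (abD n x xn))
      (fun x xn => Ff x (abD n x xn))).
  by rewrite lee_fin.
have := @fatou _ _ R mu D mD _ H g0.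
rewrite (@eq_integral _ _ R mu D (EFin \o f)); last first.
  move=> x; rewrite inE => Dx; apply: (cvg_limn_einf_sup _).1.
  apply: cvg_near_cst.
  by apply: filterS (Dab x Dx) => n xn; rewrite /g patchE mem_setE xn.
move=> /le_lt_trans; apply.
apply: (@le_lt_trans _ _ C%:E); last by rewrite ltry.
rewrite limn_einf_lim; apply: lime_le; first exact: is_cvg_einfs.
apply: nearW => n; apply: le_trans (gC n).
by apply: ereal_inf_lbound; exists n => /=.
Qed.

End Improper.

(** * Integrals of matrix functions *)

Section MatrixIntegral.
Context {R : realType} {N : nat}.
Local Notation mx := 'M[R[i]]_N.
Local Notation mu := (@lebesgue_measure R).

Definition cbasis (k : cidx) : mx :=
  (if k.1 then 0 +i* 1 else 1) *: delta_mx k.2.1 k.2.2.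

(** Reduces statements on real-linear functionals to the coordinates. *)
Lemma coord_decomp (M : mx) : M = \sum_k (coord k M) *:r cbasis k.
Proof.
rewrite {1}[M]matrix_sum_delta.
transitivity (\sum_c \sum_ij (coord (c, ij) M) *:r cbasis (c, ij)); last first.
  by rewrite pair_bigA; apply: eq_bigr => -[].
rewrite big_bool/= -big_split/= pair_bigA; apply: eq_bigr => -[i j] _.
rewrite /cbasis /coord/= !rscaleE !scalerA -scalerDl mulr1; congr (_ *: _).
by rewrite [LHS]complexE addrC mulrC.
Qed.

Lemma mx_integrableP (D : set R) (F : R -> mx) :
  mx_integrable D F <-> forall k, mu.-integrable D (EFin \o (fun t => coord k (F t))).
Proof.
split=> [h [c [i j]]|h i j]; first by have [] := h i j; case: c.
by split; [exact: (h (false, (i, j)))|exact: (h (true, (i, j)))].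
Qed.

Lemma coord_integral (D : set R) (F : R -> mx) k :
  coord k (mx_integral D F) = \int[mu]_(t in D) coord k (F t).
Proof. by rewrite /coord mxE; case: k => -[] [i j]. Qed.

Lemma eq_mx_integral (D : set R) (F G : R -> mx) :
  (forall t, D t -> F t = G t) -> mx_integral D F = mx_integral D G.
Proof.
move=> FG; apply: coord_inj => k; rewrite !coord_integral.
by apply: (@eq_Rintegral _ _ R mu D) => t; rewrite inE => /FG ->.
Qed.

Lemma Rintegral_sum (I : finType) (D : set R) (f : I -> R -> R) : measurable D ->
  (forall i, mu.-integrable D (EFin \o f i)) ->
  mu.-integrable D (EFin \o (fun t => \sum_i f i t)) /\
  \int[mu]_(t in D) (\sum_i f i t) = \sum_i \int[mu]_(t in D) f i t.
Proof.
move=> mD fi.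
suff H (s : seq I) : mu.-integrable D (EFin \o (fun t => \sum_(i <- s) f i t)) /\
    \int[mu]_(t in D) (\sum_(i <- s) f i t) = \sum_(i <- s) \int[mu]_(t in D) f i t.
  by have := H (index_enum I).
elim: s => [|i s [IH1 IH2]].
  have E : (fun t : R => \sum_(i <- [::]) f i t) = cst 0.
    by apply/funext => t; rewrite big_nil.
  rewrite big_nil E; split; first exact: (@integrable0 _ _ R mu D).
  by rewrite /Rintegral integral0.
have E : (fun t : R => \sum_(j <- i :: s) f j t) =
   (f i \+ (fun t : R => \sum_(j <- s) f j t)).
  by apply/funext => t; rewrite big_cons.
rewrite E; split; first exact: (@integrableD _ _ R mu D mD _ _ (fi i) IH1).
by rewrite big_cons -IH2 -(@RintegralD _ _ R mu D _ _ mD (fi i) IH1).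
Qed.

(** Clear on coordinates; multiplication by a fixed matrix, on either side and
    followed by a coordinate, is the instance that is used below. *)
Lemma mx_integral_linear (D : set R) (F : R -> mx) (L : {additive mx -> R}) :
  measurable D -> (forall (a : R) M, L (a *:r M) = a * L M) ->
  mx_integrable D F ->
  mu.-integrable D (EFin \o (fun t => L (F t))) /\
  \int[mu]_(t in D) L (F t) = L (mx_integral D F).
Proof.
move=> mD LZ /mx_integrableP iF.
have LE M : L M = \sum_k L (cbasis k) * coord k M.
  rewrite {1}[M]coord_decomp raddf_sum; apply: eq_bigr => k _.
  by rewrite LZ mulrC.
have E : (fun t => L (F t)) = (fun t => \sum_k L (cbasis k) * coord k (F t)).
  by apply/funext => t; rewrite LE.
have iLF k : mu.-integrable D (EFin \o (fun t => L (cbasis k) * coord k (F t))).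
  exact: (@integrableZl _ _ R mu D mD (L (cbasis k)) _ (iF k)).
have [h1 h2] := Rintegral_sum mD iLF.
rewrite E; split => //; rewrite h2 LE; apply: eq_bigr => k _.
by rewrite coord_integral (@RintegralZl _ _ R mu D _ _ mD (iF k)).
Qed.

Lemma mx_integralMl (D : set R) (F : R -> mx) (X : mx) : measurable D ->
  mx_integrable D F -> mx_integrable D (fun t => X *m F t) /\
  mx_integral D (fun t => X *m F t) = X *m mx_integral D F.
Proof.
move=> mD iF.
have LZ k (a : R) M : (coord k \o mulmx X) (a *:r M) = a * (coord k \o mulmx X) M.
  by rewrite /= rscaleMr coordZ.
have H k := @mx_integral_linear D F (coord k \o mulmx X) mD (LZ k) iF.
split; first by apply/mx_integrableP => k; have [] := H k.
by apply: coord_inj => k; rewrite coord_integral; have [] := H k.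
Qed.

Lemma mx_integralMr (D : set R) (F : R -> mx) (X : mx) : measurable D ->
  mx_integrable D F -> mx_integrable D (fun t => F t *m X) /\
  mx_integral D (fun t => F t *m X) = mx_integral D F *m X.
Proof.
move=> mD iF.
have LZ k (a : R) M : (coord k \o mulmxr X) (a *:r M) = a * (coord k \o mulmxr X) M.
  by rewrite /= rscaleMl coordZ.
have H k := @mx_integral_linear D F (coord k \o mulmxr X) mD (LZ k) iF.
split; first by apply/mx_integrableP => k; have [] := H k.
by apply: coord_inj => k; rewrite coord_integral; have [] := H k.
Qed.

Lemma mx_integralB (D : set R) (F G : R -> mx) : measurable D ->
  mx_integrable D F -> mx_integrable D G ->
  mx_integrable D (fun t => F t - G t) /\
  mx_integral D (fun t => F t - G t) = mx_integral D F - mx_integral D G.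
Proof.
move=> mD /mx_integrableP iF /mx_integrableP iG.
have E k : (fun t => coord k (F t - G t)) =
    (fun t => coord k (F t)) \- (fun t => coord k (G t)).
  by apply/funext => t; rewrite raddfB.
split.
  apply/mx_integrableP => k; rewrite E.
  exact: (@integrableB _ _ R mu D mD _ _ (iF k) (iG k)).
apply: coord_inj => k; rewrite raddfB/= !coord_integral E.
exact: (@RintegralB _ _ R mu D _ _ mD (iF k) (iG k)).
Qed.

Lemma mx_integral_sum (I : finType) (D : set R) (F : I -> R -> mx) : measurable D ->
  (forall i, mx_integrable D (F i)) ->
  mx_integrable D (fun t => \sum_i F i t) /\
  mx_integral D (fun t => \sum_i F i t) = \sum_i mx_integral D (F i).
Proof.
move=> mD iF.
have iFk k i : mu.-integrable D (EFin \o (fun t => coord k (F i t))).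
  exact: (mx_integrableP D (F i)).1.
have H k := Rintegral_sum mD (iFk k).
have E k : (fun t => coord k (\sum_i F i t)) = (fun t => \sum_i coord k (F i t)).
  by apply/funext => t; rewrite raddf_sum.
split; first by apply/mx_integrableP => k; rewrite E; have [] := H k.
apply: coord_inj => k; rewrite coord_integral E (H k).2 raddf_sum.
by apply: eq_bigr => i _; rewrite /= coord_integral.
Qed.

Definition mx_measurable (D : set R) (F : R -> mx) : Prop :=
  forall k, measurable_fun D (fun t => coord k (F t)).

Lemma continuous_mx_measurable (D : set R) (F : R -> mx) : open D ->
  (forall t, D t -> mlim (nbhs t) F (F t)) -> mx_measurable D F.
Proof.
move=> oD cF k; apply: open_continuous_measurable_fun => // t.
by rewrite inE => /cF; exact.
Qed.

Lemma dominated_mx_integrable (D : set R) (F : R -> mx) (g : R -> R) :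
  measurable D -> mx_measurable D F -> mu.-integrable D (EFin \o g) ->
  (forall t, D t -> nrm (F t) <= g t) -> mx_integrable D F.
Proof.
move=> mD mF ig Fg; apply/mx_integrableP => k.
apply: (@le_integrable _ _ R mu D mD _ _ _ _ ig).
  by apply/measurable_EFinP; exact: mF.
move=> t Dt /=; rewrite lee_fin (le_trans (coord_le_nrm _ _))//.
by rewrite (le_trans (Fg t Dt))// ler_norm.
Qed.

Lemma mx_dominated_convergence (D : set R) (F_ : nat -> R -> mx) (F : R -> mx)
    (g : R -> R) : measurable D -> (forall n, mx_measurable D (F_ n)) ->
  mu.-integrable D (EFin \o g) ->
  (forall n t, D t -> nrm (F_ n t) <= g t) ->
  (forall t, D t -> mlim \oo (F_ ^~ t) (F t)) ->
  mx_integrable D F /\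
  mlim \oo (fun n => mx_integral D (F_ n)) (mx_integral D F).
Proof.
move=> mD mF ig Fg FF.
have H k : mu.-integrable D (EFin \o (fun t => coord k (F t))) /\
    \int[mu]_(t in D) coord k (F_ n t) @[n --> \oo] --> \int[mu]_(t in D) coord k (F t).
  pose f_ n t := (coord k (F_ n t))%:E.
  have mf_ n : measurable_fun D (f_ n) by apply/measurable_EFinP; exact: mF.
  have cf t : D t -> f_ n t @[n --> \oo] --> (coord k (F t))%:E.
    by move=> Dt; apply/fine_cvgP; split; [exact: nearW|exact: FF].
  have fg n t : D t -> (`|f_ n t| <= (EFin \o g) t)%E.
    by move=> Dt; rewrite /= lee_fin (le_trans (coord_le_nrm _ _))// Fg.
  have mf := @emeasurable_fun_cvg _ _ R D f_ (EFin \o (fun t => coord k (F t))) mf_ cf.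
  have iF : mu.-integrable D (EFin \o (fun t => coord k (F t))).
    apply: (@le_integrable _ _ R mu D mD _ _ mf _ ig) => t Dt /=.
    rewrite lee_fin (le_trans (coord_le_nrm _ _))// (le_trans _ (ler_norm _))//.
    by apply: mlim_nrm_le (FF t Dt) _; apply: nearW => n; exact: Fg.
  have fing t : D t -> (EFin \o g) t \is a fin_num by [].
  have cvF := @dominated_cvg _ _ R mu D mD f_
    (EFin \o (fun t => coord k (F t))) (EFin \o g) mf_ cf fing ig fg.
  split => //.
  rewrite -(@fineK _ (\int[mu]_(x in D) _)%E) in cvF; last exact: integrable_fin_num.
  exact: fine_cvg cvF.
split; first by apply/mx_integrableP => k; have [] := H k.
by move=> k; under eq_fun do rewrite coord_integral; rewrite coord_integral; exact: (H k).2.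
Qed.

Lemma mx_integral_FTC (D : set R) a b (F dF : R -> mx) (l : mx) : exhausts D a b ->
  (forall t, D t -> mlim (nbhs t) dF (dF t)) ->
  (forall t, D t -> mder F t (dF t)) ->
  mx_integrable D dF ->
  mlim \oo (fun n => F (b n) - F (a n)) l ->
  mx_integral D dF = l.
Proof.
move=> exD cdF FD idF Fl; apply: coord_inj => k; rewrite coord_integral.
apply: (@integral_FTC_open _ D a b _ (fun t => coord k (F t))) => //.
- by move=> t /cdF; exact.
- by move=> t Dt; exact: FD.
- exact: (mx_integrableP D dF).1.
- by have := Fl k; under eq_fun do rewrite raddfB/=.
Qed.

End MatrixIntegral.

(** * Commuting families of matrices *)

Section Commutation.
Context {R : realType} {N : nat}.
Local Notation mx := 'M[R[i]]_N.
Local Notation mu := (@lebesgue_measure R).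
Implicit Types (X Y P Q : mx).

Lemma comm_invmx X Y : comm_mx X Y -> comm_mx X (invmx Y).
Proof.
move=> XY; have [uY|nuY] := boolP (Y \in unitmx); last by rewrite invmx_out.
rewrite /comm_mx; apply: (can_inj (mulKmx uY)).
by rewrite mulmxA -XY mulmxK// mulKVmx.
Qed.

Lemma pochS X k : poch X k.+1 = poch X k *m (X + (k%:R)%:M).
Proof. by rewrite /poch big_ord_recr. Qed.

Lemma comm_shift X Y k : comm_mx X Y -> comm_mx X (Y + (k%:R)%:M).
Proof. by move=> XY; apply: comm_mxD => //; exact: comm_mx_scalar. Qed.

Lemma comm_poch X Y k : comm_mx X Y -> comm_mx X (poch Y k).
Proof.
move=> XY; elim: k => [|k IH]; first by rewrite /poch big_ord0; exact: comm_mx1.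
by rewrite pochS; apply: comm_mxM => //; exact: comm_shift.
Qed.

Lemma poch_unit X k : positive_stable X -> poch X k \in unitmx.
Proof.
move=> psX; elim: k => [|k IH]; first by rewrite /poch big_ord0 unitmx1.
by rewrite pochS unitmx_mul IH addn_unit.
Qed.

Lemma comm_integral (D : set R) X (F : R -> mx) : measurable D ->
  mx_integrable D F -> (forall t, D t -> comm_mx X (F t)) ->
  comm_mx X (mx_integral D F).
Proof.
move=> mD iF XF; rewrite /comm_mx -(mx_integralMl X mD iF).2 -(mx_integralMr X mD iF).2.
by apply: eq_mx_integral => t /XF.
Qed.

End Commutation.

(** * Exhausting segments and the Beta dominating function *)

Section Exhaustions.
Context {R : realType}.
Local Notation mu := (@lebesgue_measure R).

(** The shift by 3 keeps the segment from eps n to 1 - eps n nondegenerate for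
    every n. *)
Definition eps (n : nat) : R := n.+3%:R^-1.

Lemma eps_gt0 n : 0 < eps n.
Proof. by rewrite /eps invr_gt0. Qed.

Lemma eps_lt n : eps n < 2^-1.
Proof. by rewrite /eps ltf_pV2 ?posrE// ltr_nat. Qed.

Lemma in01_eps n : 0 < eps n <= 1 /\ 0 < 1 - eps n <= 1.
Proof.
have := eps_gt0 n; have := eps_lt n => h1 h2.
by split; apply/andP; split; lra.
Qed.

Lemma cvg_eps : eps n @[n --> \oo] --> 0.
Proof.
have : @harmonic R n @[n --> \oo] --> 0 by exact: cvg_harmonic.
rewrite -(cvg_shiftn 2); apply: cvg_trans; apply: near_eq_cvg; apply: nearW => n.
by rewrite /= addn2.
Qed.

Lemma eps_small x : 0 < x -> \forall n \near \oo, eps n <= x.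
Proof.
move=> x0; have /cvgrPdist_le/(_ _ x0) := cvg_eps.
by apply: filterS => n; rewrite sub0r normrN gtr0_norm ?eps_gt0.
Qed.

Lemma cvg_powR_eps alpha : 0 < alpha -> (eps n) `^ alpha @[n --> \oo] --> 0.
Proof.
move=> a0; have /cvg_at_rightP := @powR_cvg0 R alpha a0; apply; split.
  exact: eps_gt0.
exact: cvg_eps.
Qed.

Lemma exhausts_01 : exhausts (`]0, 1[ : set R) eps (fun n => 1 - eps n).
Proof.
split => //.
- by move=> n; have := eps_lt n; lra.
- move=> n x; rewrite /= !in_itv/= => /andP[h1 h2].
  by have := eps_gt0 n; lra.
- move=> x; rewrite /= in_itv/= => /andP[x0 x1].
  have y0 : 0 < 1 - x by lra.
  near=> n; rewrite in_itv/=; apply/andP; split; first by near: n; exact: eps_small.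
  rewrite lerBrDr -lerBrDl; near: n; exact: eps_small.
Unshelve. all: by end_near. Qed.

Lemma exhausts_0y : exhausts (`]0, +oo[ : set R) eps (fun n => n.+3%:R).
Proof.
split => //.
- move=> n; have := eps_lt n; have : 1 <= n.+3%:R :> R by rewrite ler1n.
  lra.
- move=> n x; rewrite /= !in_itv/= andbT => /andP[h1 h2].
  by have := eps_gt0 n; lra.
- move=> x; rewrite /= in_itv/= andbT => x0.
  have y0 : 0 < x^-1 by rewrite invr_gt0.
  near=> n; rewrite in_itv/=; apply/andP; split; first by near: n; exact: eps_small.
  rewrite -[x]invrK -[n.+3%:R]invrK lef_pV2 ?posrE ?eps_gt0//; near: n; exact: eps_small.
Unshelve. all: by end_near. Qed.

Lemma is_derive_powR (a t : R) : 0 < t ->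
  is_derive t 1 (fun t : R => t `^ a) (a * (t^-1 * t `^ a)).
Proof.
move=> t0; have ty : t \in `]0, +oo[ by rewrite in_itv/= t0.
apply: DeriveDef; first exact: derivable_powR.
rewrite -derive1E powR_derive1// powRB ?powRr1 ?ltW//; last first.
  by apply/implyP => _; rewrite gt_eqF.
by rewrite [_^-1 * _]mulrC.
Qed.

Lemma is_derive_1B (f : R -> R) (t d : R) : is_derive (1 - t) 1 f d ->
  is_derive t 1 (fun t => f (1 - t)) (- d).
Proof.
move=> fd; have h : is_derive t 1 (fun t : R => 1 - t) (- 1 : R).
  have := is_deriveB (is_derive_cst (1 : R) t 1) (is_derive_id t 1).
  by move/is_derive_eq; apply; rewrite sub0r.
rewrite -[- d]mulrN1; exact: (@is_derive1_comp _ f (fun t : R => 1 - t)) fd h.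
Qed.

(** Bounds t^(al - 1) (1 - t)^(be - 1), because 1 / (t (1 - t)) is
    1 / t + 1 / (1 - t) and the powers al and be are at most 1 on (0, 1). *)
Definition beta_dom (al be t : R) : R := t^-1 * t `^ al + (1 - t)^-1 * (1 - t) `^ be.

Lemma powR_le1 (t a : R) : 0 <= t <= 1 -> 0 < a -> t `^ a <= 1.
Proof.
move=> /andP[t0 t1] a0; have <- : 1 `^ a = 1 by rewrite powR1.
by apply: ge0_ler_powR => //; rewrite ?ltW// nnegrE.
Qed.

Lemma beta_dom_integrable (al be : R) : 0 < al -> 0 < be ->
  mu.-integrable `]0, 1[ (EFin \o beta_dom al be).
Proof.
move=> al0 be0.
have ct (a t : R) : 0 < t -> {for t, continuous (fun t : R => t^-1 * t `^ a)}.
  move=> t0; apply: cvgM; first by apply: cvgV => //; rewrite gt_eqF.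
  exact: is_derive_cvg (is_derive_powR a t0).
apply: (@integrable_FTC_open _ _ _ _ _
  (fun t => al^-1 * t `^ al - be^-1 * (1 - t) `^ be) (al^-1 + be^-1) _ exhausts_01).
- exact: interval_open.
- move=> t; rewrite /= in_itv/= => /andP[t0 t1].
  apply: cvgD; first exact: ct.
  apply: (@continuous_comp _ _ _ (fun t : R => 1 - t) (fun t : R => t^-1 * t `^ be)).
    by apply: cvgB; [exact: cvg_cst|exact: cvg_id].
  by apply: ct; rewrite subr_gt0.
- move=> t; rewrite /= in_itv/= => /andP[t0 t1].
  by rewrite addr_ge0// mulr_ge0 ?powR_ge0// invr_ge0 ?subr_ge0 ltW.
- move=> t; rewrite /= in_itv/= => /andP[t0 t1].
  have u0 : 0 < 1 - t by rewrite subr_gt0.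
  have h1 := is_derive_mul (is_derive_cst (al^-1) t 1) (is_derive_powR al t0).
  have h2 := is_derive_mul (is_derive_cst (be^-1) t 1) (is_derive_1B (is_derive_powR be u0)).
  apply: (is_derive_eq (is_deriveB h1 h2)).
  rewrite /cst !mul0r !add0r !mulrN opprK !mulrA !mulVf ?gt_eqF// !mul1r.
  by [].
- move=> n.
  have e0 := eps_gt0 n; have e1 := eps_lt n.
  have h (x a : R) : 0 <= x <= 1 -> 0 < a -> 0 <= a^-1 * x `^ a <= a^-1.
    move=> x01 a0; have a0' : 0 <= a^-1 by rewrite invr_ge0 ltW.
    by rewrite mulr_ge0 ?powR_ge0//= -[leRHS]mulr1 ler_wpM2l// powR_le1.
  have /andP[_ A] : 0 <= al^-1 * (1 - eps n) `^ al <= al^-1 by apply: h => //; lra.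
  have /andP[B _] : 0 <= be^-1 * (1 - (1 - eps n)) `^ be <= be^-1 by apply: h => //; lra.
  have /andP[C _] : 0 <= al^-1 * (eps n) `^ al <= al^-1 by apply: h => //; lra.
  have /andP[_ E] : 0 <= be^-1 * (1 - eps n) `^ be <= be^-1 by apply: h => //; lra.
  lra.
Qed.

End Exhaustions.

(** * The Beta integral *)

Definition beta_kernel {R : realType} {N : nat} (P Q : 'M[R[i]]_N) (t : R) :
    'M[R[i]]_N :=
  mpow t (P - 1%:M) *m mpow (1 - t) (Q - 1%:M).

HB.lock Definition mxBeta {R : realType} {N : nat} (P Q : 'M[R[i]]_N) : 'M[R[i]]_N :=
  mx_integral `]0, 1[ (beta_kernel P Q).

Section Beta.
Context {R : realType} {N : nat}.
Local Notation mx := 'M[R[i]]_N.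
Local Notation mu := (@lebesgue_measure R).
Implicit Types (X P Q : mx) (t : R).

Lemma mxBetaE P Q : mxBeta P Q = mx_integral `]0, 1[ (beta_kernel P Q).
Proof. by rewrite unlock. Qed.

Lemma add1K X : X + 1%:R%:M - 1%:M = X.
Proof. by rewrite addrK. Qed.

Lemma in01 t : `]0, 1[%classic t -> 0 < t /\ t < 1.
Proof. by rewrite /= in_itv/= => /andP. Qed.

Lemma beta_kernel_dominated P Q : positive_stable P -> positive_stable Q ->
  exists2 g : R -> R, mu.-integrable `]0, 1[ (EFin \o g) &
  forall t, `]0, 1[%classic t -> nrm (beta_kernel P Q t) <= g t.
Proof.
move=> /mpow_decay[al al0 [c c0 cP]] /mpow_decay[be be0 [d d0 dP]].
exists (fun t => (c * d) * beta_dom al be t).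
  apply: (@integrableZl _ _ R mu _ _ (c * d) (EFin \o beta_dom al be)) => //.
  exact: beta_dom_integrable.
move=> t /in01[t0 t1]; have u0 : 0 < 1 - t by rewrite subr_gt0.
rewrite /beta_kernel (mpowB1 P t0) (mpowB1 Q u0).
apply: (le_trans (ler_nrmM _ _)).
rewrite !nrmZ.
rewrite !ger0_norm ?invr_ge0 ?(ltW u0) ?(ltW t0)//.
have cPt := cP t; have dPt := dP (1 - t).
apply: (@le_trans _ _ ((t^-1 * (c * t `^ al)) * ((1 - t)^-1 * (d * (1 - t) `^ be)))).
  apply: ler_pM; rewrite ?mulr_ge0 ?nrm_ge0 ?invr_ge0 ?(ltW u0) ?(ltW t0)//.
    by rewrite ler_wpM2l ?invr_ge0 ?(ltW t0)// cPt// t0 ltW.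
  by rewrite ler_wpM2l ?invr_ge0 ?(ltW u0)// dPt// u0/=; lra.
have -> : t^-1 * (c * t `^ al) * ((1 - t)^-1 * (d * (1 - t) `^ be)) =
    c * d * ((t^-1 * t `^ al) * (1 - t) `^ be + ((1 - t)^-1 * (1 - t) `^ be) * t `^ al).
  by field; rewrite !gt_eqF.
rewrite ler_wpM2l ?mulr_ge0// /beta_dom lerD// -[leRHS]mulr1 ler_wpM2l
  ?mulr_ge0 ?powR_ge0 ?invr_ge0 ?(ltW u0) ?(ltW t0)//.
  by apply: powR_le1 => //; lra.
by apply: powR_le1 => //; lra.
Qed.

Lemma mlim_mpow X t : 0 < t -> mlim (nbhs t) (fun s => mpow s X) (mpow t X).
Proof. by move=> t0; exact: mder_cvg (mder_mpow X t0). Qed.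

Lemma mlim_mpow1B X t : t < 1 ->
  mlim (nbhs t) (fun s => mpow (1 - s) X) (mpow (1 - t) X).
Proof. by move=> t1; exact: mder_cvg (mder_mpow1B X t1). Qed.

Lemma beta_kernel_continuous P Q t : `]0, 1[%classic t ->
  mlim (nbhs t) (beta_kernel P Q) (beta_kernel P Q t).
Proof.
by move=> /in01[t0 t1]; apply: mlimM; [exact: mlim_mpow|exact: mlim_mpow1B].
Qed.

Lemma open01 : open (`]0, 1[%classic : set R). Proof. exact: interval_open. Qed.

Lemma beta_kernel_measurable P Q : mx_measurable `]0, 1[ (beta_kernel P Q).
Proof.
by apply: continuous_mx_measurable => [|t]; [exact: open01|exact: beta_kernel_continuous].
Qed.

Lemma beta_kernel_integrable P Q : positive_stable P -> positive_stable Q ->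
  mx_integrable `]0, 1[ (beta_kernel P Q).
Proof.
move=> psP psQ; have [g ig gP] := beta_kernel_dominated psP psQ.
by apply: dominated_mx_integrable ig gP => //; exact: beta_kernel_measurable.
Qed.

Lemma comm_mxBeta X P Q : positive_stable P -> positive_stable Q ->
  comm_mx X P -> comm_mx X Q -> comm_mx X (mxBeta P Q).
Proof.
move=> psP psQ XP XQ; rewrite mxBetaE; apply: comm_integral => // [|t _].
  exact: beta_kernel_integrable.
by apply: comm_mxM; apply: comm_mpow; apply: comm_mxB => //; exact: comm_mx1.
Qed.

(** The two sides are the two terms of the integral of the derivative of
    t^P (1 - t)^Q, which vanishes at both ends. *)
Lemma mxBeta_balance P Q : comm_mx P Q -> positive_stable P -> positive_stable Q ->
  P *m mxBeta P (Q + 1%:R%:M) = Q *m mxBeta (P + 1%:R%:M) Q.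
Proof.
move=> PQ psP psQ; apply/eqP; rewrite -subr_eq0; apply/eqP.
have psP1 := positive_stable_addn (k := 1%N) psP; have psQ1 := positive_stable_addn (k := 1%N) psQ.
have m01 : measurable (`]0, 1[%classic : set R) by [].
have i1 := mx_integralMl P m01 (beta_kernel_integrable psP psQ1).
have i2 := mx_integralMl Q m01 (beta_kernel_integrable psP1 psQ).
have i3 := mx_integralB m01 i1.1 i2.1.
rewrite !mxBetaE -i1.2 -i2.2 -i3.2.
apply: (mx_integral_FTC (F := fun t => mpow t P *m mpow (1 - t) Q) exhausts_01) i3.1 _.
- by move=> t t01; apply: mlimB; apply: mlimMl; exact: beta_kernel_continuous.
- move=> t /in01[t0 t1].
  apply: mder_eq (mderM (mder_mpow P t0) (mder_mpow1B Q t1)) _.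
  rewrite /beta_kernel !add1K mulmxN !mulmxA; congr (_ - _ *m _).
  by rewrite (comm_mpow t (esym PQ : comm_mx Q P)).
- have [al al0 [c c0 cP]] := mpow_decay psP.
  have [be be0 [d d0 dP]] := mpow_decay psQ.
  have e01 n : 0 < @eps R n <= 1 := (in01_eps n).1.
  have f01 n : 0 < 1 - @eps R n <= 1 := (in01_eps n).2.
  have p1 (x a : R) : 0 < x <= 1 -> 0 < a -> x `^ a <= 1.
    by move=> /andP[/ltW x0 x1] a0; apply: powR_le1; rewrite ?x0.
  apply: (@mlim_squeeze _ _ _ _ _ _ _ (fun n => c * d * (eps n) `^ be + c * d * (eps n) `^ al)).
    apply: nearW => n; rewrite subr0 (le_trans (ler_nrmB _ _))// subKr; apply: lerD.
      rewrite (le_trans (ler_nrmM _ _))//.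
      apply: (@le_trans _ _ (c * (d * (eps n) `^ be))); last by rewrite mulrA.
      apply: ler_pM; rewrite ?nrm_ge0 ?dP// (le_trans (cP _ (f01 n)))//.
      by rewrite -[leRHS]mulr1 ler_wpM2l ?p1.
    rewrite (le_trans (ler_nrmM _ _))//.
    apply: (@le_trans _ _ ((c * (eps n) `^ al) * d)); last by apply: eqler; ring.
    apply: ler_pM; rewrite ?nrm_ge0 ?cP// (le_trans (dP _ (f01 n)))//.
    by rewrite -[leRHS]mulr1 ler_wpM2l ?p1.
  rewrite -[X in _ --> X](_ : c * d * 0 + c * d * 0 = 0); last by rewrite mulr0 addr0.
  by apply: cvgD; apply: cvgM => //; try exact: cvg_cst; exact: cvg_powR_eps.
Qed.

(** The two integrands add up because t + (1 - t) = 1. *)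
Lemma mxBeta_split P Q : positive_stable P -> positive_stable Q ->
  mxBeta (P + 1%:R%:M) Q + mxBeta P (Q + 1%:R%:M) = mxBeta P Q.
Proof.
move=> psP psQ.
have psP1 := positive_stable_addn (k := 1%N) psP; have psQ1 := positive_stable_addn (k := 1%N) psQ.
have m01 : measurable (`]0, 1[%classic : set R) by [].
have iN := mx_integralB m01 (beta_kernel_integrable psP psQ) (beta_kernel_integrable psP1 psQ).
apply/esym/eqP; rewrite addrC -subr_eq; apply/eqP; rewrite !mxBetaE -iN.2.
apply: eq_mx_integral => t /in01[t0 t1].
have u0 : 0 < 1 - t by rewrite subr_gt0.
rewrite /beta_kernel addrAC [Q + _ - _]addrAC !mpowDnat// !expr1.
by rewrite rscaleMl rscaleMr rscaleBl rscale1.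
Qed.

Lemma mxBetaSl P Q : comm_mx P Q -> positive_stable P -> positive_stable Q ->
  (P + Q) *m mxBeta (P + 1%:R%:M) Q = P *m mxBeta P Q.
Proof.
move=> PQ psP psQ.
by rewrite mulmxDl -(mxBeta_balance PQ psP psQ) -mulmxDr mxBeta_split.
Qed.

Lemma mxBetaSr P Q : comm_mx P Q -> positive_stable P -> positive_stable Q ->
  (P + Q) *m mxBeta P (Q + 1%:R%:M) = Q *m mxBeta P Q.
Proof.
move=> PQ psP psQ.
by rewrite mulmxDl (mxBeta_balance PQ psP psQ) -mulmxDr mxBeta_split.
Qed.

Lemma shiftS P k : P + k.+1%:R%:M = P + k%:R%:M + 1%:R%:M :> mx.
Proof. by rewrite -addrA -raddfD/= -natrD addn1. Qed.

Lemma mxBeta_pochl P Q k : comm_mx P Q -> positive_stable P -> positive_stable Q ->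
  poch (P + Q) k *m mxBeta (P + k%:R%:M) Q = poch P k *m mxBeta P Q.
Proof.
move=> PQ psP psQ; elim: k => [|k IH].
  by rewrite /poch !big_ord0 raddf0 addr0.
rewrite !pochS shiftS -mulmxA.
have -> : P + Q + k%:R%:M = P + k%:R%:M + Q by rewrite addrAC.
have kQ : comm_mx (P + k%:R%:M) Q by apply/comm_mx_sym/comm_shift/comm_mx_sym.
have psk := positive_stable_addn (k := k) psP.
rewrite (mxBetaSl kQ psk psQ).
have cc : comm_mx (P + k%:R%:M) (poch (P + Q) k).
  apply: comm_poch; apply: comm_mxD => //.
  by apply/comm_mx_sym/comm_shift.
rewrite mulmxA -cc -(mulmxA (P + k%:R%:M)) IH mulmxA; congr (_ *m _).
by apply: comm_poch; apply/comm_mx_sym/comm_shift.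
Qed.

Lemma mxBeta_pochr P Q k : comm_mx P Q -> positive_stable P -> positive_stable Q ->
  poch (P + Q) k *m mxBeta P (Q + k%:R%:M) = poch Q k *m mxBeta P Q.
Proof.
move=> PQ psP psQ; elim: k => [|k IH].
  by rewrite /poch !big_ord0 raddf0 addr0.
rewrite !pochS shiftS -mulmxA.
have -> : P + Q + k%:R%:M = P + (Q + k%:R%:M) by rewrite addrA.
have kQ : comm_mx P (Q + k%:R%:M) by exact: comm_shift.
have psk := positive_stable_addn (k := k) psQ.
rewrite (mxBetaSr kQ psP psk).
have cc : comm_mx (Q + k%:R%:M) (poch (P + Q) k).
  apply: comm_poch; apply: comm_mxD.
    exact/comm_mx_sym/comm_shift.
  by apply/comm_mx_sym/comm_shift.
rewrite mulmxA -cc -(mulmxA (Q + k%:R%:M)) IH mulmxA; congr (_ *m _).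
by apply: comm_poch; apply/comm_mx_sym/comm_shift.
Qed.

End Beta.

(** * Scalar bounds for the Gamma integral *)

Section RealBounds.
Context {R : realType}.
Local Notation mu := (@lebesgue_measure R).
Implicit Types (s t u x al : R).

Lemma bernoulli_le (y : R) n : 0 <= y <= 1 -> 1 - n%:R * y <= (1 - y) ^+ n.
Proof.
move=> /andP[y0 y1]; elim: n => [|n IH]; first by rewrite mul0r subr0 expr0.
rewrite exprS; apply: (@le_trans _ _ ((1 - y) * (1 - n%:R * y))); last first.
  by rewrite ler_wpM2l// subr_ge0.
have : 0 <= n%:R * y ^+ 2 by rewrite mulr_ge0// exprn_ge0.
by rewrite -natr1; lra.
Qed.

(** Both bounds on (1 - s/m)^m come from 1 - x <= e^-x and
    (1 - x) e^x >= 1 - x^2. *)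
Lemma euler_power_bounds (m : nat) s : (0 < m)%N -> 0 <= s <= m%:R ->
  expR (- s) * (1 - s ^+ 2 / m%:R) <= (1 - s / m%:R) ^+ m <= expR (- s).
Proof.
move=> m0 /andP[s0 sm]; have mr0 : 0 < m%:R :> R by rewrite ltr0n.
set x := s / m%:R.
have x0 : 0 <= x by rewrite divr_ge0// ltW.
have x1 : x <= 1 by rewrite ler_pdivrMr// mul1r.
have sE : - s = m%:R * - x by rewrite /x; field; rewrite gt_eqF.
have eE : expR (- s) = expR (- x) ^+ m by rewrite sE expRM_natl.
have le1 : 1 - x <= expR (- x) by exact: expR_ge1Dx.
apply/andP; split; last first.
  by rewrite eE lerXn2r// ?nnegrE ?subr_ge0// expR_ge0.
have le2 : expR (- x) * (1 - x ^+ 2) <= 1 - x.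
  have -> : 1 - x ^+ 2 = (1 + x) * (1 - x) by ring.
  rewrite mulrA -[leRHS]mul1r ler_wpM2r ?subr_ge0//.
  by rewrite -[leRHS](expRxMexpNx_1 x) mulrC ler_wpM2r ?expR_ge0// expR_ge1Dx.
have x2 : 0 <= x ^+ 2 <= 1 by rewrite exprn_ge0//= exprn_ile1.
have /andP[_ x21] := x2.
apply: (@le_trans _ _ (expR (- s) * (1 - x ^+ 2) ^+ m)).
  rewrite ler_wpM2l ?expR_ge0//.
  have -> : s ^+ 2 / m%:R = m%:R * x ^+ 2 by rewrite /x; field; rewrite gt_eqF.
  exact: bernoulli_le.
rewrite eE -exprMn lerXn2r// nnegrE ?subr_ge0//.
by rewrite mulr_ge0 ?expR_ge0// subr_ge0.
Qed.

Lemma cvg_euler_power s : 0 <= s ->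
  (1 - s / n.+1%:R) ^+ n.+1 @[n --> \oo] --> expR (- s).
Proof.
move=> s0.
apply: (@squeeze_cvgr _ _ _ _ (fun n => expR (- s) * (1 - s ^+ 2 / n.+1%:R)) (fun=> expR (- s))).
- have [k sk] : exists k : nat, s <= k.+1%:R.
    by exists (Num.trunc s); rewrite ltW// Num.Theory.truncnS_gt.
  exists k => // n /= kn; apply: euler_power_bounds => //.
  by rewrite s0 (le_trans sk)// ler_nat ltnS.
- rewrite -[X in _ --> X]mulr1; apply: cvgM; first exact: cvg_cst.
  rewrite -[X in _ --> X]subr0; apply: cvgB; first exact: cvg_cst.
  rewrite -[X in _ --> X](mulr0 (s ^+ 2)); apply: cvgM; first exact: cvg_cst.
  exact: cvg_harmonic.
- exact: cvg_cst.
Qed.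

(** Up to constants this is t^(al - 1) at 0 and e^(-t/2) at infinity, but it has
    an elementary primitive, namely a multiple of (1 - e^(-t/2))^al. *)
Definition gamma_dom al t : R :=
  (1 - expR (- t / 2))^-1 * (1 - expR (- t / 2)) `^ al * expR (- t / 2).

Definition gamma_u t : R := 1 - expR (- t / 2).

Lemma gamma_u_itv t : 0 < t -> 0 < gamma_u t /\ gamma_u t <= t /\ gamma_u t <= 1.
Proof.
move=> t0; rewrite /gamma_u; split.
  by rewrite subr_gt0 expR_lt1; lra.
split; first by have := expR_ge1Dx (- t / 2); lra.
by rewrite lerBlDr lerDl expR_ge0.
Qed.

Lemma is_derive_gamma_u t : is_derive t 1 gamma_u (2^-1 * expR (- t / 2)).
Proof.
have h : is_derive t 1 (fun t : R => expR (t * - 2^-1)) (- 2^-1 * expR (t * - 2^-1)).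
  exact: is_derive_expRZ.
have := is_deriveB (is_derive_cst (1 : R) t 1) h.
rewrite (_ : cst 1 - _ = gamma_u); last first.
  apply/funext => x; change (1 - expR (x * - 2^-1) = gamma_u x).
  by rewrite /gamma_u mulrN mulNr.
by move/is_derive_eq; apply; rewrite sub0r mulNr opprK mulrN mulNr.
Qed.

Lemma gamma_dom_integrable al : 0 < al -> mu.-integrable `]0, +oo[ (EFin \o gamma_dom al).
Proof.
move=> al0.
have cu t : {for t, continuous gamma_u} by exact: is_derive_cvg (is_derive_gamma_u t).
have E : gamma_dom al = (fun t => (gamma_u t)^-1 * (gamma_u t) `^ al * (1 - gamma_u t)).
  by apply/funext => t; rewrite /gamma_dom /gamma_u subKr.
apply: (@integrable_FTC_open _ _ _ _ _
  (fun t => 2 / al * (gamma_u t) `^ al) (2 / al) _ exhausts_0y).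
- exact: interval_open.
- move=> t; rewrite /= in_itv/= andbT => t0; have [u0 _] := gamma_u_itv t0.
  rewrite E; apply: cvgM; last by apply: cvgB; [exact: cvg_cst|exact: cu].
  apply: cvgM; first by apply: cvgV; [rewrite gt_eqF|exact: cu].
  apply: (@continuous_comp _ _ _ gamma_u (fun u => u `^ al)); first exact: cu.
  exact: is_derive_cvg (is_derive_powR al u0).
- move=> t; rewrite /= in_itv/= andbT => t0; have [u0 _] := gamma_u_itv t0.
  by rewrite /gamma_dom -/(gamma_u t) !mulr_ge0 ?powR_ge0 ?expR_ge0// invr_ge0 ltW.
- move=> t; rewrite /= in_itv/= andbT => t0; have [u0 _] := gamma_u_itv t0.
  have h1 : is_derive t 1 (fun t => (gamma_u t) `^ al)
      (al * ((gamma_u t)^-1 * (gamma_u t) `^ al) * (2^-1 * expR (- t / 2))).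
    exact: (@is_derive1_comp _ (fun u => u `^ al) gamma_u) (is_derive_powR al u0)
      (is_derive_gamma_u t).
  apply: (is_derive_eq (is_derive_mul (is_derive_cst (2 / al) t 1) h1)).
  rewrite /cst mul0r add0r /gamma_dom -/(gamma_u t).
  by field; rewrite !gt_eqF.
- move=> n.
  have h t : 0 < t -> 0 <= (gamma_u t) `^ al <= 1.
    move=> t0; have [u0 [_ u1]] := gamma_u_itv t0.
    by rewrite powR_ge0 powR_le1// (ltW u0).
  have c0 : 0 <= 2 / al by rewrite divr_ge0// ltW.
  have /andP[_ A] := h n.+3%:R (ltr0n _ _).
  have /andP[B _] := h _ (@eps_gt0 R n).
  rewrite -mulrBr -[leRHS]mulr1; apply: ler_wpM2l => //.
  by rewrite lerBlDr (le_trans A)// lerDl.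
Qed.

Lemma powRV_mono u s al : 0 < u -> u <= s -> 0 < al <= 1 ->
  s^-1 * s `^ al <= u^-1 * u `^ al.
Proof.
move=> u0 us /andP[al0 al1]; have s0 := lt_le_trans u0 us.
have E x : 0 < x -> x^-1 * x `^ al = (x `^ (1 - al))^-1.
  move=> x0; rewrite -powRN opprB powRB; last by apply/implyP => _; rewrite gt_eqF.
  by rewrite powRr1 ?ltW// mulrC.
rewrite !E// lef_pV2 ?posrE ?powR_gt0//; apply: ge0_ler_powR => //.
- by rewrite subr_ge0.
- by rewrite nnegrE ltW.
- by rewrite nnegrE ltW.
Qed.

Lemma gamma_dom_small al t : 0 < t -> 0 < al <= 1 ->
  t^-1 * t `^ al * expR (- t) <= gamma_dom al t.
Proof.
move=> t0 al01; have [u0 [ut _]] := gamma_u_itv t0.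
rewrite /gamma_dom -/(gamma_u t); apply: ler_pM;
  rewrite ?expR_ge0 ?mulr_ge0 ?powR_ge0 ?invr_ge0 ?(ltW t0)//.
  exact: powRV_mono.
by rewrite ler_expR; lra.
Qed.

Lemma gamma_dom_large al t : 0 < t -> 0 < al <= 1 -> expR (- t / 2) <= gamma_dom al t.
Proof.
move=> t0 al01; have [u0 [_ u1]] := gamma_u_itv t0.
rewrite /gamma_dom -/(gamma_u t) -[leLHS]mul1r ler_wpM2r ?expR_ge0//.
have := @powRV_mono (gamma_u t) 1 al u0 u1 al01.
by rewrite invr1 mul1r powR1.
Qed.

(** Comparison with a single term of the exponential series. *)
Lemma expR_dominates_powR (m : R) : exists2 K : R, 0 <= K &
  forall t, 1 <= t -> expR (ln t * m) * expR (- t / 2) <= K.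
Proof.
have [k mk] : exists k : nat, m <= k.+1%:R.
  have [m0|m0] := leP 0 m; last by exists 0%N; rewrite (le_trans (ltW m0)).
  by exists (Num.trunc m); rewrite ltW// Num.Theory.truncnS_gt.
exists (2 ^+ k.+1 * k.+1`!%:R) => [|t t1]; first by rewrite mulr_ge0 ?exprn_ge0.
have t0 : 0 < t by rewrite (lt_le_trans _ t1).
apply: (@le_trans _ _ (t ^+ k.+1 * expR (- t / 2))).
  rewrite ler_wpM2r ?expR_ge0//.
  rewrite -[t in leRHS]lnK ?posrE// -expRM_natr ler_expR ler_wpM2l// ln_ge0//.
have h : (t / 2) ^+ k.+1 / k.+1`!%:R <= expR (t / 2).
  by apply: le_trans (expR_ge1Dxn k _); rewrite ?lerDr// divr_ge0// ltW.
rewrite mulNr expRN ler_pdivrMr ?expR_gt0//.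
have f0 : 0 < k.+1`!%:R :> R by rewrite ltr0n fact_gt0.
move: h; rewrite ler_pdivrMr// expr_div_n ler_pdivrMr ?exprn_gt0// => h.
by apply: (le_trans h); apply: eqler; ring.
Qed.

End RealBounds.

(** * Rescaling an integral *)

Section Scaling.
Context {R : realType}.
Local Notation mu := (@lebesgue_measure R).

Lemma exhausts_scale (c : R) : 0 < c ->
  exhausts (`]0, c[%classic : set R) (fun n => c * eps n) (fun n => c * (1 - eps n)).
Proof.
move=> c0; have [_ h1 h2 h3] := @exhausts_01 R.
split => //.
- by move=> n; rewrite ltr_pM2l.
- move=> n x; rewrite /= !in_itv/= => /andP[l1 l2].
  have := @eps_gt0 R n; have := @eps_lt R n => e1 e0.
  apply/andP; split; first by rewrite (lt_le_trans _ l1)// mulr_gt0.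
  by rewrite (le_lt_trans l2)// gtr_pMr//; lra.
- move=> x; rewrite /= in_itv/= => /andP[x0 xc].
  have /h3 : `]0, 1[%classic (x / c).
    by rewrite /= in_itv/= divr_gt0//= ltr_pdivrMr// mul1r.
  apply: filterS => n; rewrite !in_itv/= ler_pdivlMr// ler_pdivrMr//.
  by rewrite ![_ * c]mulrC.
Qed.

Lemma Rintegral_scale_segment (f : R -> R) (c a b : R) : 0 < c -> a < b ->
  (forall x, x \in `[a, b] -> {for x, continuous f}) ->
  \int[mu]_(x in `[c * a, c * b]) f (x / c) = c * \int[mu]_(x in `[a, b]) f x.
Proof.
move=> c0 ab fc.
pose F x : R := c * x.
have F' (x : R) : is_derive x 1 F c.
  apply: (is_derive_eq (is_derive_mul (is_derive_cst c x 1) (is_derive_id x 1))).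
  by rewrite /cst mul0r add0r mulr1.
have F'E : derive1 F = cst c by apply/funext => x; rewrite derive1E derive_val.
have inV x : F x / c = x by rewrite /F mulrAC divff ?mul1r// gt_eqF.
have H : (\int[mu]_(x in `[F a, F b]) (f (x / c))%:E =
    \int[mu]_(x in `[a, b]) ((((fun x => f (x / c)) \o F) * derive1 F) x)%:E)%E.
  apply: integration_by_substitution_increasing; rewrite ?F'E ?ltW//.
  - by move=> x y _ _ xy; rewrite /F ltr_pM2l.
  - by move=> x _; exact: cvg_cst.
  - exact: is_cvg_cst.
  - exact: is_cvg_cst.
  - split.
    + by move=> x _; exact: ex_derive.
    + by apply: cvg_at_right_filter; exact: is_derive_cvg.
    + by apply: cvg_at_left_filter; exact: is_derive_cvg.
  - apply: continuous_within_pt => x; rewrite in_itv/= => /andP[x1 x2].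
    have h : y / c @[y --> x] --> x / c by apply: cvgM; [exact: cvg_id|exact: cvg_cst].
    apply: (cvg_comp _ _ h).
    by apply: fc; rewrite in_itv/= ler_pdivlMr// ler_pdivrMr// ![_ * c]mulrC x1.
have fi : mu.-integrable `[a, b] (EFin \o f).
  apply: continuous_compact_integrable; first exact: segment_compact.
  exact: continuous_within_pt.
rewrite -(@RintegralZl _ _ R mu `[a, b] f c _ fi)//.
rewrite /Rintegral -/(F a) -/(F b) H F'E; congr fine; apply: eq_integral => x _.
by rewrite -{2}(inV x) mulrC.
Qed.

(** The substitution is made on the exhausting segments, where f is continuous up
    to the ends. *)
Lemma Rintegral_scale (f : R -> R) (c : R) : 0 < c ->
  (forall x, `]0, 1[%classic x -> {for x, continuous f}) ->
  mu.-integrable `]0, 1[ (EFin \o f) ->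
  mu.-integrable `]0, c[ (EFin \o (fun x => f (x / c))) ->
  \int[mu]_(x in `]0, c[) f (x / c) = c * \int[mu]_(x in `]0, 1[) f x.
Proof.
move=> c0 fc i1 ic.
have l1 := exhausts_cvg (@exhausts_01 R) i1.
have lc := exhausts_cvg (exhausts_scale c0) ic.
apply: (cvg_unique _ lc) => //.
have : c * \int[mu]_(x in `[eps n, 1 - eps n]) f x @[n --> \oo] -->
    c * \int[mu]_(x in `]0, 1[) f x by apply: cvgM => //; exact: cvg_cst.
apply: cvg_trans; apply: near_eq_cvg; apply: nearW => n /=.
have [_ h1 h2 _] := @exhausts_01 R.
by rewrite (Rintegral_scale_segment c0 (h1 n))// => x /(h2 n); exact: fc.
Qed.

End Scaling.

(** * Gamma as a limit of Beta integrals *)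

Definition gamma_kernel {R : realType} {N : nat} (P : 'M[R[i]]_N) (t : R) : 'M[R[i]]_N :=
  expR (- t) *:r mpow t (P - 1%:M).

HB.lock Definition mGamma {R : realType} {N : nat} (P : 'M[R[i]]_N) : 'M[R[i]]_N :=
  mx_integral `]0, +oo[ (gamma_kernel P).

Section GammaLimit.
Context {R : realType} {N : nat}.
Local Notation mx := 'M[R[i]]_N.
Local Notation mu := (@lebesgue_measure R).
Implicit Types (X P Q : mx) (t s : R).

Lemma mGammaE P : mGamma P = mx_integral `]0, +oo[ (gamma_kernel P).
Proof. by rewrite unlock. Qed.

(** Near 0 the bound is the decay of t^P. For t >= 1 the crude bound by
    a multiple of t^|P| is absorbed by half of the exponential. *)
Lemma gamma_kernel_dominated P : positive_stable P ->
  exists2 g : R -> R, mu.-integrable `]0, +oo[ (EFin \o g) &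
  forall t, 0 < t -> nrm (gamma_kernel P t) <= g t.
Proof.
move=> psP; have [al' al'0 [c c0 cP]] := mpow_decay psP.
pose al := Num.min al' 1.
have al0 : 0 < al by rewrite lt_min al'0 ltr01.
have al1 : al <= 1 by rewrite ge_min lexx orbT.
have al01 : 0 < al <= 1 by rewrite al0.
have [K K0 KP] := expR_dominates_powR (nrm P).
pose n1 := nrm (1%:M : mx); have n10 : 0 <= n1 := nrm_ge0 _.
exists (fun t => (c + n1 * K) * gamma_dom al t).
  apply: (@integrableZl _ _ R mu _ _ (c + n1 * K) (EFin \o gamma_dom al)) => //.
  exact: gamma_dom_integrable.
move=> t t0; have e0 := expR_ge0 (- t).
have ti : 0 <= t^-1 by rewrite invr_ge0 ltW.
rewrite /gamma_kernel (mpowB1 P t0) rscaleA nrmZ ger0_norm ?mulr_ge0//.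
have g0 : 0 <= gamma_dom al t.
  exact: le_trans (expR_ge0 _) (gamma_dom_large t0 al01).
rewrite mulrDl; have [t1|t1] := leP t 1.
  apply: (@le_trans _ _ (c * gamma_dom al t)).
    2: by rewrite lerDl; apply: mulr_ge0 => //; exact: mulr_ge0.
  apply: (@le_trans _ _ (c * (t^-1 * t `^ al * expR (- t)))); last first.
    by apply: ler_wpM2l => //; exact: gamma_dom_small.
  have le1 : nrm (mpow t P) <= c * t `^ al.
    apply: (le_trans (cP t _)); first by rewrite t0.
    by apply: ler_wpM2l => //; apply: ger_powR; [rewrite t0|rewrite ge_min lexx].
  apply: (@le_trans _ _ (expR (- t) * t^-1 * (c * t `^ al))).
    by apply: ler_wpM2l => //; rewrite mulr_ge0.
  by apply: eqler; ring.
apply: (@le_trans _ _ (n1 * K * gamma_dom al t)); last by rewrite lerDr mulr_ge0.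
apply: (@le_trans _ _ (n1 * K * expR (- t / 2))); last first.
  by apply: ler_wpM2l; [rewrite mulr_ge0|exact: gamma_dom_large].
have le1 : nrm (mpow t P) <= n1 * expR (ln t * nrm P).
  by have := nrm_mpow t P; rewrite ger0_norm// ln_ge0// ltW.
apply: (@le_trans _ _ (expR (- t) * (n1 * expR (ln t * nrm P)))).
  apply: ler_pM; rewrite ?mulr_ge0 ?nrm_ge0//.
  by rewrite -[leRHS]mulr1 ler_wpM2l// invf_le1// ltW.
have -> : expR (- t) = expR (- t / 2) * expR (- t / 2).
  by rewrite -expRD; congr expR; field.
apply: (@le_trans _ _ (n1 * (expR (ln t * nrm P) * expR (- t / 2)) * expR (- t / 2))).
  by apply: eqler; ring.
apply: ler_wpM2r; first exact: expR_ge0.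
by apply: ler_wpM2l => //; apply: KP; exact: ltW.
Qed.

Lemma in0y t : `]0, +oo[%classic t -> 0 < t.
Proof. by rewrite /= in_itv/= andbT. Qed.

Lemma mlim_mpow_comp {T} {F : set_system T} {FF : ProperFilter F} (f : T -> R) (l : R) X :
  0 < l -> f x @[x --> F] --> l -> mlim F (fun x => mpow (f x) X) (mpow l X).
Proof.
move=> l0 fl k.
have h : mlim (nbhs l) (fun s => mpow s X) (mpow l X) by exact: mlim_mpow.
exact: (cvg_comp _ _ fl (h k)).
Qed.

Lemma gamma_kernel_measurable P : mx_measurable `]0, +oo[%classic (gamma_kernel P).
Proof.
apply: continuous_mx_measurable; first exact: interval_open.
move=> t /in0y t0; apply: mlimZ; last exact: mlim_mpow.
have h : expR y @[y --> - t] --> expR (- t) by exact: continuous_expR.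
have k : - s @[s --> t] --> - t by apply: cvgN; exact: cvg_id.
exact: (cvg_comp _ _ k h).
Qed.

Lemma gamma_kernel_integrable P : positive_stable P ->
  mx_integrable `]0, +oo[%classic (gamma_kernel P).
Proof.
move=> psP; have [g ig gP] := gamma_kernel_dominated psP.
apply: dominated_mx_integrable ig _ => //; first exact: gamma_kernel_measurable.
by move=> t /in0y; exact: gP.
Qed.

Lemma comm_mGamma X P : positive_stable P -> comm_mx X P -> comm_mx X (mGamma P).
Proof.
move=> psP XP; rewrite mGammaE; apply: comm_integral => // [|t _].
  exact: gamma_kernel_integrable.
rewrite /comm_mx /gamma_kernel rscaleMr rscaleMl; congr (_ *:r _).
by apply: comm_mpow; apply: comm_mxB => //; exact: comm_mx1.
Qed.

(** The integrand of m^P B(P, Q + m + 1) after the substitution t = s / m,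
    extended by 0 to the half-line. *)
Definition scaled_kernel P Q (m : nat) t : mx :=
  if 0 < t < m%:R then (1 - t / m%:R) ^+ m *:r (mpow t (P - 1%:M) *m mpow (1 - t / m%:R) Q)
  else 0.

Lemma scaled_kernelE P Q (m : nat) t : (0 < m)%N -> 0 < t < m%:R ->
  scaled_kernel P Q m t =
  m%:R^-1 *:r (mpow m%:R P *m beta_kernel P (Q + m.+1%:R%:M) (t / m%:R)).
Proof.
move=> m0 /andP[t0 tm]; have mr0 : 0 < m%:R :> R by rewrite ltr0n.
have u0 : 0 < 1 - t / m%:R by rewrite subr_gt0 ltr_pdivrMr// mul1r.
have tm0 : 0 < t / m%:R by rewrite divr_gt0.
have E : mpow t (P - 1%:M) = m%:R^-1 *:r (mpow m%:R P *m mpow (t / m%:R) (P - 1%:M)).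
  have tE : t = m%:R * (t / m%:R) by rewrite mulrCA divff ?mulr1// gt_eqF.
  by rewrite {1}tE (mpowM _ mr0 tm0) (mpowB1 P mr0) rscaleMl.
rewrite /scaled_kernel t0 tm /beta_kernel shiftS add1K (mpowDnat _ _ u0).
by rewrite !rscaleMr E rscaleMl !rscaleA mulrC mulmxA.
Qed.

Lemma scaled_kernel_measurable P Q (m : nat) : (0 < m)%N ->
  mx_measurable `]0, +oo[%classic (scaled_kernel P Q m).
Proof.
move=> m0 k; have mr0 : 0 < m%:R :> R by rewrite ltr0n.
pose F t : mx :=
  (1 - t / m%:R) ^+ m *:r (mpow t (P - 1%:M) *m mpow (1 - t / m%:R) Q).
have cF : mx_measurable `]0, m%:R[%classic F.
  apply: continuous_mx_measurable; first exact: interval_open.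
  move=> t; rewrite /= in_itv/= => /andP[t0 tm].
  have u0 : 0 < 1 - t / m%:R by rewrite subr_gt0 ltr_pdivrMr// mul1r.
  have h : 1 - s / m%:R @[s --> t] --> 1 - t / m%:R.
    by apply: cvgB; [exact: cvg_cst|apply: cvgM; [exact: cvg_id|exact: cvg_cst]].
  apply: mlimZ; first exact: (cvg_comp _ _ h (@exprn_continuous R m _)).
  apply: mlimM; first exact: mlim_mpow.
  exact: mlim_mpow_comp.
have m1 : measurable (`]0, m%:R[%classic : set R) by [].
have m2 : measurable (`]0, +oo[%classic : set R) by [].
rewrite (_ : (fun t => _) = (fun t => coord k (F t)) \_ `]0, m%:R[%classic); last first.
  apply/funext => t; rewrite /scaled_kernel patchE mem_setE in_itv/=.
  by case: ifPn => tm //; rewrite raddf0.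
apply/(measurable_restrict _ m1 m2).
rewrite (_ : _ `&` _ = `]0, m%:R[%classic); first exact: cF.
apply/setIidPr => t; rewrite /= !in_itv/= andbT.
by case/andP.
Qed.

(** Uniformly in m, because (1 - t / m)^m <= e^(- t). *)
Lemma scaled_kernel_dominated P Q (m : nat) (d : R) t : (0 < m)%N ->
  (forall u, 0 < u <= 1 -> nrm (mpow u Q) <= d) -> 0 <= d -> 0 < t ->
  nrm (scaled_kernel P Q m t) <= d * nrm (gamma_kernel P t).
Proof.
move=> m0 dQ d0 t0; have mr0 : 0 < m%:R :> R by rewrite ltr0n.
rewrite /scaled_kernel t0/=; case: ifPn => tm; last by rewrite nrm0 mulr_ge0 ?nrm_ge0.
have u0 : 0 < 1 - t / m%:R by rewrite subr_gt0 ltr_pdivrMr// mul1r.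
have u1 : 1 - t / m%:R <= 1 by rewrite gerBl divr_ge0// ltW.
rewrite nrmZ ger0_norm; last by rewrite exprn_ge0// ltW.
rewrite /gamma_kernel nrmZ ger0_norm ?expR_ge0//.
rewrite mulrCA; apply: ler_pM; rewrite ?nrm_ge0//; first by rewrite exprn_ge0// ltW.
  by have /andP[] := @euler_power_bounds R m t m0 (introT andP (conj (ltW t0) (ltW tm))).
apply: (le_trans (ler_nrmM _ _)); rewrite mulrC.
by apply: ler_wpM2r; [exact: nrm_ge0|apply: dQ; rewrite u0].
Qed.

Lemma cvg_scaled_kernel P Q t : 0 < t ->
  mlim \oo (fun n => scaled_kernel P Q n.+1 t) (gamma_kernel P t).
Proof.
move=> t0 k.
have lim : mlim \oo (fun n => (1 - t / n.+1%:R) ^+ n.+1 *:r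
    (mpow t (P - 1%:M) *m mpow (1 - t / n.+1%:R) Q)) (gamma_kernel P t).
  have -> : gamma_kernel P t = expR (- t) *:r (mpow t (P - 1%:M) *m mpow 1 Q).
    by rewrite mpow1 mulmx1.
  apply: mlimZ; first by apply: cvg_euler_power; exact: ltW.
  apply: mlimMl; apply: mlim_mpow_comp => //.
  rewrite -[X in _ --> X]subr0; apply: cvgB; first exact: cvg_cst.
  rewrite -[X in _ --> X](mulr0 t); apply: cvgM; first exact: cvg_cst.
  exact: cvg_harmonic.
apply: cvg_trans (lim k); apply: near_eq_cvg.
exists (Num.trunc t).+1 => // n /= tn.
have tn' : t < n.+1%:R.
  rewrite (lt_le_trans (Num.Theory.truncnS_gt _))// ler_nat.
  exact: leqW.
by rewrite /scaled_kernel t0 tn'.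
Qed.

Lemma mx_integral_scaled_kernel P Q (m : nat) : (0 < m)%N ->
  positive_stable P -> positive_stable (Q + m.+1%:R%:M) ->
  mx_integrable `]0, +oo[%classic (scaled_kernel P Q m) ->
  mx_integral `]0, +oo[%classic (scaled_kernel P Q m) =
  mpow m%:R P *m mxBeta P (Q + m.+1%:R%:M).
Proof.
move=> m0 psP psQ iF; have mr0 : 0 < m%:R :> R by rewrite ltr0n.
pose H u : mx := m%:R^-1 *:r (mpow m%:R P *m beta_kernel P (Q + m.+1%:R%:M) u).
have m01 : measurable (`]0, 1[%classic : set R) by [].
have m0m : measurable (`]0, m%:R[%classic : set R) by [].
have m0y : measurable (`]0, +oo[%classic : set R) by [].
have sub : `]0, m%:R[%classic `<=` (`]0, +oo[%classic : set R).
  by move=> t; rewrite /= !in_itv/= andbT => /andP[].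
have FH t : `]0, m%:R[%classic t -> scaled_kernel P Q m t = H (t / m%:R).
  by rewrite /= in_itv/= => tm; exact: scaled_kernelE.
have [iB iBE] := mx_integralMl (mpow m%:R P) m01 (beta_kernel_integrable psP psQ).
have iH k : mu.-integrable `]0, 1[%classic (EFin \o (fun u => coord k (H u))).
  rewrite (_ : (fun u => _) = (fun u => m%:R^-1 *
      coord k (mpow m%:R P *m beta_kernel P (Q + m.+1%:R%:M) u))); last first.
    by apply/funext => u; rewrite coordZ.
  exact: (@integrableZl _ _ R mu _ m01 (m%:R^-1) _ (proj1 (mx_integrableP _ _) iB k)).
apply: coord_inj => k; rewrite coord_integral.
have cH u : `]0, 1[%classic u -> {for u, continuous (fun u => coord k (H u))}.
  move=> u01; rewrite (_ : (fun u => _) = (fun u => m%:R^-1 *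
      coord k (mpow m%:R P *m beta_kernel P (Q + m.+1%:R%:M) u))); last first.
    by apply/funext => v; rewrite coordZ.
  apply: cvgM; first exact: cvg_cst.
  have h : mlim (nbhs u) (fun v => mpow m%:R P *m beta_kernel P (Q + m.+1%:R%:M) v)
      (mpow m%:R P *m beta_kernel P (Q + m.+1%:R%:M) u).
    by apply: mlimMl; exact: beta_kernel_continuous.
  exact: h.
have iHm : mu.-integrable `]0, m%:R[%classic (EFin \o (fun t => coord k (H (t / m%:R)))).
  have := @integrableS _ _ R mu _ _ _ m0y m0m sub (proj1 (mx_integrableP _ _) iF k).
  by apply: (@eq_integrable _ _ R mu _ m0m) => t; rewrite inE => /FH /= ->.
have -> : \int[mu]_(t in `]0, +oo[) coord k (scaled_kernel P Q m t) =
    \int[mu]_(t in `]0, m%:R[) coord k (H (t / m%:R)).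
  transitivity (\int[mu]_(t in `]0, +oo[%classic `&` `]0, m%:R[%classic) coord k (H (t / m%:R))).
    rewrite Rintegral_mkcondr; apply: (@eq_Rintegral _ _ R mu) => t _.
    rewrite patchE mem_setE in_itv/=; case: ifPn => tm.
      by rewrite FH//= in_itv.
    by rewrite /scaled_kernel (negbTE tm) raddf0.
  by rewrite (setIidr sub).
rewrite (Rintegral_scale mr0 cH (iH k) iHm).
rewrite (_ : (fun u => _) = (fun u => m%:R^-1 *
      coord k (mpow m%:R P *m beta_kernel P (Q + m.+1%:R%:M) u))); last first.
  by apply/funext => u; rewrite coordZ.
rewrite (@RintegralZl _ _ R mu _ _ _ m01 (proj1 (mx_integrableP _ _) iB k)).
by rewrite mulrA divff ?gt_eqF// mul1r mxBetaE -iBE coord_integral.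
Qed.

(** The integrands converge to e^(- t) t^(P - 1), because (1 - t / m)^m converges
    to e^(- t) and (1 - t / m)^Q to 1. The bound on u^Q holds both for Q = 0 and
    for a positive stable Q. *)
Lemma cvg_mxBeta_mGamma P Q (d : R) : positive_stable P ->
  (forall m : nat, positive_stable (Q + m.+1%:R%:M)) ->
  (forall u, 0 < u <= 1 -> nrm (mpow u Q) <= d) -> 0 <= d ->
  mlim \oo (fun n => mpow n.+1%:R P *m mxBeta P (Q + n.+2%:R%:M)) (mGamma P).
Proof.
move=> psP psQ dQ d0.
have m0y : measurable (`]0, +oo[%classic : set R) by [].
have [g ig gP] := gamma_kernel_dominated psP.
have idg : mu.-integrable `]0, +oo[%classic (EFin \o (fun t => d * g t)).
  exact: (@integrableZl _ _ R mu _ m0y d _ ig).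
have dom n t : `]0, +oo[%classic t -> nrm (scaled_kernel P Q n.+1 t) <= d * g t.
  move=> /in0y t0; apply: (le_trans (@scaled_kernel_dominated P Q n.+1 d t (ltn0Sn n) dQ d0 t0)).
  by apply: ler_wpM2l => //; exact: gP.
have mF n := @scaled_kernel_measurable P Q n.+1 (ltn0Sn n).
have pw t : `]0, +oo[%classic t ->
    mlim \oo (fun n => scaled_kernel P Q n.+1 t) (gamma_kernel P t).
  by move=> /in0y; exact: cvg_scaled_kernel.
have [_ lim] := mx_dominated_convergence m0y mF idg dom pw.
rewrite mGammaE; move: lim; apply: eq_mlim => n.
have iFn := dominated_mx_integrable m0y (mF n) idg (dom n).
exact: (mx_integral_scaled_kernel (ltn0Sn n) psP (psQ n.+1) iFn).
Qed.

End GammaLimit.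

(** * Euler's limit formula *)

Section EulerProduct.
Context {R : realType} {N : nat}.
Local Notation mx := 'M[R[i]]_N.
Implicit Types (X P Q : mx) (t s x : R).

Lemma positive_stable_nat (k : nat) : positive_stable (k.+1%:R%:M : mx).
Proof.
move=> a /eigenvalueP[v vk v0].
have : (a - k.+1%:R) *: v = 0.
  by rewrite scalerBl -vk mul_mx_scalar subrr.
move/eqP; rewrite scaler_eq0 (negbTE v0) orbF subr_eq0 => /eqP ->.
rewrite -[k.+1%:R](rmorph_nat (real_complex R)).
exact: ltr0Sn.
Qed.

Lemma poch_recl P k : poch P k.+1 = P *m poch (P + 1%:M) k.
Proof.
elim: k => [|k IH].
  by rewrite pochS /poch !big_ord0 mul1mx mulmx1 raddf0 addr0.
rewrite pochS IH -mulmxA; congr (_ *m _).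
by rewrite pochS -addrA -raddfD/= nat1r.
Qed.

Lemma poch1 k : poch (1%:M : mx) k = k`!%:R%:M.
Proof.
elim: k => [|k IH]; first by rewrite /poch big_ord0 fact0.
by rewrite pochS IH -raddfD/= -scalar_mxM nat1r factS mulnC natrM.
Qed.

(** The kernel is the derivative of t^P up to the factor P. *)
Lemma mxBeta_1 P : positive_stable P -> P *m mxBeta P 1%:M = 1%:M.
Proof.
move=> psP; have ps1 : positive_stable (1%:M : mx) := @positive_stable_nat 0%N.
have m01 : measurable (`]0, 1[%classic : set R) by [].
have [iB iBE] := mx_integralMl P m01 (beta_kernel_integrable psP ps1).
rewrite mxBetaE -iBE.
apply: (mx_integral_FTC (F := fun t => mpow t P) (@exhausts_01 R)) iB _.
- by move=> t t01; apply: mlimMl; exact: beta_kernel_continuous.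
- move=> t /in01[t0 t1]; apply: mder_eq (mder_mpow P t0) _.
  by rewrite /beta_kernel subrr mpow0 mulmx1.
- rewrite -[X in mlim _ _ X]subr0; apply: mlimB.
    rewrite -(mpow1 P); apply: mlim_mpow_comp => //.
    rewrite -[X in _ --> X]subr0; apply: cvgB; first exact: cvg_cst.
    exact: cvg_eps.
  have [al al0 [c c0 cP]] := mpow_decay psP.
  apply: (@mlim_squeeze _ _ _ _ _ _ _ (fun n => c * (eps n) `^ al)).
    by apply: nearW => n; rewrite subr0; apply: cP; exact: (in01_eps n).1.
  rewrite -[X in _ --> X](mulr0 c); apply: cvgM; first exact: cvg_cst.
  exact: cvg_powR_eps.
Qed.

Definition euler_term (m : nat) P : mx :=
  m`!%:R *:r (mpow m%:R P *m invmx (poch P m.+1)).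

Lemma mxBeta_nat P n : positive_stable P ->
  mxBeta P (n.+2%:R%:M) = n.+1`!%:R *:r invmx (poch P n.+2).
Proof.
move=> psP; have ps1 : positive_stable (1%:M : mx) := @positive_stable_nat 0%N.
have uP := poch_unit n.+2 psP.
have c1 : comm_mx P 1%:M by exact: comm_mx1.
have := mxBeta_pochr n.+1 c1 psP ps1.
have -> : 1%:M + n.+1%:R%:M = n.+2%:R%:M :> mx by rewrite -raddfD/= nat1r.
move=> h.
apply: (can_inj (mulKmx uP)).
rewrite rscaleMr mulmxV// poch_recl -mulmxA h poch1.
rewrite mulmxA scalar_mxC -mulmxA mxBeta_1// mulmx1.
by rewrite -scalemx1 rscaleE rmorph_nat.
Qed.

(** The case Q = 0 of the previous limit, where the Beta integral is explicit. *)
Lemma cvg_euler_term P : positive_stable P ->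
  mlim \oo (fun n => euler_term n.+1 P) (mGamma P).
Proof.
move=> psP.
have psk m : positive_stable (0 + m.+1%:R%:M : mx).
  by rewrite add0r; exact: positive_stable_nat.
have b0 u : 0 < u <= 1 -> nrm (mpow u (0 : mx)) <= nrm (1%:M : mx).
  by rewrite mpow0.
have H := @cvg_mxBeta_mGamma R N P 0 (nrm (1%:M : mx)) psP psk b0 (nrm_ge0 _).
apply: eq_mlim H => n.
by rewrite add0r (mxBeta_nat n psP) rscaleMr.
Qed.


(** The partial products of the infinite product for the inverse of Gamma. *)
Definition euler_inv (m : nat) P : mx :=
  m`!%:R^-1 *:r (mpow m%:R (- P) *m poch P m.+1).

Lemma euler_termK m P : positive_stable P -> euler_term m P *m euler_inv m P = 1%:M.
Proof.
move=> psP; have uP := poch_unit m.+1 psP.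
have f0 : m`!%:R != 0 :> R by rewrite pnatr_eq0 -lt0n fact_gt0.
rewrite /euler_term /euler_inv rscaleMl rscaleMr rscaleA divff// rscale1.
have c : comm_mx (mpow m%:R (- P)) (poch P m.+1).
  apply: comm_poch; apply: comm_mx_sym; apply: comm_mpow.
  by rewrite /comm_mx mulmxN mulNmx.
by rewrite c -mulmxA (mulmxA (invmx _)) mulVmx// mul1mx mpowN.
Qed.

(** The quotient of consecutive inverse approximants, for x = 1 / (m + 1). *)
Definition euler_factor P x : mx := (1%:M + x *:r P) *m mpow (1 - x) P.

Lemma euler_invS (m : nat) P : euler_inv m.+2 P =
  euler_inv m.+1 P *m euler_factor P (m.+2%:R^-1).
Proof.
have k1 : 0 < m.+1%:R :> R by [].
have k2 : 0 < m.+2%:R :> R by [].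
have k0 : m.+2%:R != 0 :> R by rewrite pnatr_eq0.
have xE : 1 - m.+2%:R^-1 = m.+1%:R / m.+2%:R :> R.
  by apply: (mulIf k0); rewrite mulrBl mul1r mulVf// divfK// -[m.+2%:R]natr1 addrK.
have comP : comm_mx P (- P) by rewrite /comm_mx mulmxN mulNmx.
have cc t : comm_mx P (mpow t P) by exact: comm_mpow.
have cN t : comm_mx P (mpow t (- P)) by exact: comm_mpow.
have pw : mpow m.+2%:R (- P) = mpow m.+1%:R (- P) *m mpow (1 - m.+2%:R^-1) P.
  have e : m.+1%:R = (1 - m.+2%:R^-1) * m.+2%:R :> R by rewrite xE divfK.
  have u0 : 0 < 1 - m.+2%:R^-1 :> R by rewrite xE divr_gt0.
  rewrite {1}e (mpowM _ u0 k2) -[RHS]mulmxA.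
  have c2 : comm_mx (mpow m.+2%:R (- P)) (mpow (1 - m.+2%:R^-1) P).
    by apply: comm_mpow; apply: comm_mx_sym; exact: cN.
  rewrite c2 mulmxA.
  have := mpowN (1 - m.+2%:R^-1) (- P); rewrite opprK => ->.
  by rewrite mul1mx.
rewrite /euler_inv /euler_factor pw (pochS P m.+2) rscaleMl factS natrM invfM.
rewrite mulrC -rscaleA; congr (_ *:r _).
have sc : m.+2%:R^-1 *:r (P + m.+2%:R%:M) = 1%:M + m.+2%:R^-1 *:r P.
  rewrite rscaleDr addrC; congr (_ + _).
  rewrite rscaleE -scalemx1 scalerA -[m.+2%:R : R[i]](rmorph_nat (real_complex R)).
  by rewrite -rmorphM mulVf// scale1r.
rewrite -sc -!mulmxA -rscaleMr; congr (_ *m _).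
set U := mpow (1 - _) P.
have cU : comm_mx U (poch P m.+2) by apply: comm_poch; apply: comm_mx_sym; exact: cc.
have cU2 : comm_mx (P + m.+2%:R%:M) U.
  by apply: comm_mx_sym; apply: comm_shift; apply: comm_mx_sym; exact: cc.
by rewrite rscaleMl rscaleMr cU2 !mulmxA cU.
Qed.

End EulerProduct.

(** * Invertibility of Gamma and its relation to Beta *)

Section GammaInvertible.
Context {R : realType} {N : nat}.
Local Notation mx := 'M[R[i]]_N.
Implicit Types (X P Q : mx) (t s x : R).

Lemma nrm_mpow_half P : exists2 K : R, 0 <= K &
  forall u : R, 2^-1 <= u <= 1 -> nrm (mpow u P) <= K.
Proof.
exists (nrm (1%:M : mx) * expR (ln 2 * nrm P)).
  by rewrite mulr_ge0 ?nrm_ge0 ?expR_ge0.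
move=> u /andP[u2 u1]; apply: (le_trans (nrm_mpow u P)).
have u0 : 0 < u by rewrite (lt_le_trans _ u2).
apply: ler_wpM2l; first exact: nrm_ge0.
rewrite ler_expR; apply: ler_wpM2r; first exact: nrm_ge0.
rewrite ler0_norm ?ln_le0// -lnV ?posrE// ler_ln ?posrE ?invr_gt0//.
by rewrite -[leRHS]invrK lef_pV2 ?posrE.
Qed.

(** The factors of the Euler product are 1 + O(x^2), since the derivative
    of (1 + x P)(1 - x)^P is - x P (1 + P) (1 - x)^(P - 1). *)
Lemma euler_factor_bound P : exists2 C : R, 0 <= C &
  forall x : R, 0 <= x <= 2^-1 -> nrm (euler_factor P x - 1%:M) <= C * x ^+ 2.
Proof.
have [K K0 KP] := nrm_mpow_half (P - 1%:M).
pose c := nrm (P + P *m P) * K.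
have c0 : 0 <= c by rewrite mulr_ge0 ?nrm_ge0.
pose n := #|{: @cidx N}|%:R : R.
exists (n * (c / 2)); first by rewrite mulr_ge0// divr_ge0.
move=> x /andP[x0 x1].
pose dF (y : R) : mx := (- y) *:r ((P + P *m P) *m mpow (1 - y) (P - 1%:M)).
have := @mder_mean_value R N (euler_factor P) dF (fun y => c / 2 * (y * y))
  (fun y => c * y) 0 x x0.
have -> : euler_factor P 0 = 1%:M by rewrite /euler_factor rscale0 addr0 subr0 mpow1 mul1mx.
rewrite -/n mul0r mulr0 subr0 -expr2 mulrA; apply.
- move=> y /andP[y0 yx].
  have y1 : y < 1 by rewrite (le_lt_trans yx)// (le_lt_trans x1)// invf_lt1// ltr1n.
  have u0 : 0 < 1 - y by rewrite subr_gt0.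
  have h : mder (fun y : R => 1%:M + y *:r P) y P.
    apply: mder_eq (mderD (mder_cst _ _) (mderZ (is_derive_id y 1) (mder_cst P y))) _.
    by rewrite add0r rscale1 rscaler0 addr0.
  apply: mder_eq (mderM h (mder_mpow1B P y1)) _.
  have -> : mpow (1 - y) P = (1 - y) *:r mpow (1 - y) (P - 1%:M).
    by rewrite (mpowB1 P u0) rscaleA divff ?gt_eqF// rscale1.
  rewrite /dF rscaleMr mulmxN mulmxA -mulNmx -rscaleMl -mulmxDl -rscaleMl; congr (_ *m _).
  rewrite mulmxDl mul1mx rscaleMl rscaleBl rscale1 rscaleNr rscaleDr.
  by rewrite !opprD addrACA subrr add0r.
- move=> y _.
  apply: (is_derive_eq (is_derive_mul (is_derive_cst (c / 2) y 1)
    (is_derive_mul (is_derive_id y 1) (is_derive_id y 1)))).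
  by rewrite /cst/=; field.
- move=> y /andP[y0 yx]; rewrite /dF nrmZ normrN ger0_norm// mulrC.
  apply: ler_wpM2r => //; apply: (le_trans (ler_nrmM _ _)).
  apply: ler_wpM2l; first exact: nrm_ge0.
  by apply: KP; apply/andP; split; lra.
Qed.

(** The product of the 1 + C / n^2 is bounded; the induction replaces
    1 / (n + 2)^2 by the telescoping 1 / (n + 1) - 1 / (n + 2). *)
Lemma euler_inv_bounded P : exists2 B : R, 0 <= B &
  forall n, nrm (euler_inv n.+1 P) <= B.
Proof.
have [C C0 CP] := euler_factor_bound P.
pose b := nrm (euler_inv 1 P); have b0 : 0 <= b := nrm_ge0 _.
suff H n : nrm (euler_inv n.+1 P) <= b * expR (C * (1 - n.+1%:R^-1)).
  exists (b * expR C) => [|n]; first by rewrite mulr_ge0 ?expR_ge0.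
  apply: (le_trans (H n)); apply: ler_wpM2l => //.
  by rewrite ler_expR -[leRHS]mulr1 ler_wpM2l// gerBl invr_ge0.
elim: n => [|n IH]; first by rewrite invr1 subrr mulr0 expR0 mulr1.
set x : R := n.+2%:R^-1.
have x0 : 0 <= x by rewrite invr_ge0.
have x2 : x <= 2^-1 by rewrite lef_pV2 ?posrE// ler_nat.
have xy : x ^+ 2 <= n.+1%:R^-1 - x.
  have n1 : 0 < n.+1%:R :> R by [].
  have n2 : 0 < n.+2%:R :> R by [].
  have -> : n.+1%:R^-1 - x = n.+1%:R^-1 * x.
    have b1 : n.+1%:R + 1 = n.+2%:R :> R by rewrite natr1.
    by rewrite /x -b1; move: (n.+1%:R : R) n1 => a a0; field; rewrite !gt_eqF//; lra.
  by rewrite expr2 ler_wpM2r// lef_pV2 ?posrE// ler_nat.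
rewrite euler_invS -/x.
have -> : euler_inv n.+1 P *m euler_factor P x =
    euler_inv n.+1 P + euler_inv n.+1 P *m (euler_factor P x - 1%:M).
  by rewrite mulmxBr mulmx1 addrC subrK.
apply: (le_trans (ler_nrmD _ _)).
apply: (@le_trans _ _ (nrm (euler_inv n.+1 P) * (1 + C * x ^+ 2))).
  rewrite mulrDr mulr1 lerD2l; apply: (le_trans (ler_nrmM _ _)).
  by apply: ler_wpM2l; [exact: nrm_ge0|apply: CP; rewrite x0].
apply: (@le_trans _ _ (b * expR (C * (1 - n.+1%:R^-1)) * expR (C * x ^+ 2))).
  apply: ler_pM; rewrite ?nrm_ge0 ?addr_ge0 ?mulr_ge0 ?exprn_ge0//.
  exact: expR_ge1Dx.
rewrite -mulrA -expRD; apply: ler_wpM2l => //.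
rewrite ler_expR -mulrDr; apply: ler_wpM2l => //.
by move: (x ^+ 2) (n.+1%:R^-1) xy => q r; lra.
Qed.

(** If X Gamma(P) = 0, then X is the product of X times the Euler approximants,
    which tends to 0, and of their bounded inverses. *)
Lemma mGamma_unit P : positive_stable P -> mGamma P \in unitmx.
Proof.
move=> psP; rewrite -row_free_unit -kermx_eq0; apply/eqP.
set X := kermx _; apply: nrm0_eq0; apply/eqP; rewrite eq_le nrm_ge0 andbT.
have [B B0 BP] := euler_inv_bounded P.
have XG : X *m mGamma P = 0 by exact: mulmx_ker.
have lim : mlim \oo (fun n => X *m euler_term n.+1 P) (0 : mx).
  by rewrite -XG; apply: mlimMl; exact: cvg_euler_term.
have nlim : nrm (X *m euler_term n.+1 P) * B @[n --> \oo] --> 0.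
  rewrite -[X in _ --> X](mul0r B) -(@nrm0 R N); apply: cvgM; last exact: cvg_cst.
  exact: cvg_nrm.
have /cvg_lim <- // := nlim.
apply: limr_ge; first by apply/cvg_ex; exists 0.
apply: nearW => n.
rewrite -[leLHS](_ : nrm (X *m euler_term n.+1 P *m euler_inv n.+1 P) = _); last first.
  by rewrite -mulmxA (euler_termK _ psP) mulmx1.
apply: (le_trans (ler_nrmM _ _)).
by apply: ler_wpM2l; [exact: nrm_ge0|exact: BP].
Qed.

(** The Pochhammer products of Q and P + Q from the recurrence of Beta are exactly
    those of the two Euler approximants. *)
Lemma mxBeta_shift_euler m P Q : comm_mx P Q -> positive_stable P ->
  positive_stable Q -> positive_stable (P + Q) ->
  euler_term m Q *m (mpow m%:R P *m mxBeta P (Q + m.+1%:R%:M)) =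
  euler_term m (P + Q) *m mxBeta P Q.
Proof.
move=> PQ psP psQ psPQ.
have := mxBeta_pochr m.+1 PQ psP psQ.
have ud := poch_unit m.+1 psPQ; have uc := poch_unit m.+1 psQ.
set be := mxBeta P Q; set be' := mxBeta P _.
rewrite /euler_term; set c := poch Q _ in uc *; set d := poch (P + Q) _ in ud *.
move=> h; have -> : be' = invmx d *m (c *m be) by rewrite -h mulKmx.
rewrite !rscaleMl (mpowD _ PQ); congr (_ *:r _).
set a := mpow _ P; set b := mpow _ Q.
have QPQ : comm_mx Q (P + Q) by apply: comm_mxD => //; exact: comm_mx_sym.
have ab : comm_mx a b.
  apply: comm_mpow; apply: comm_mx_sym; apply: comm_mpow; exact: comm_mx_sym.
have Qa : comm_mx Q a by apply: comm_mpow; exact: comm_mx_sym.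
have ca : comm_mx a (invmx c).
  by apply: comm_invmx; apply: comm_poch; apply: comm_mx_sym.
have cd : comm_mx (invmx d) (invmx c).
  apply: comm_invmx; apply: comm_poch; apply: comm_mx_sym.
  by apply: comm_invmx; apply: comm_poch.
rewrite !mulmxA ab -!mulmxA; congr (_ *m _).
rewrite (mulmxA (invmx c) a) -ca -!mulmxA; congr (_ *m _).
by rewrite (mulmxA (invmx c) (invmx d)) -cd -!mulmxA mulKmx.
Qed.

(** Both sides are limits of the two members of the preceding identity. *)
Lemma mxBeta_mGamma P Q : comm_mx P Q -> positive_stable P ->
  positive_stable Q -> positive_stable (P + Q) ->
  mGamma (P + Q) *m mxBeta P Q = mGamma Q *m mGamma P.
Proof.
move=> PQ psP psQ psPQ.
have [al al0 [c c0 cQ]] := mpow_decay psQ.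
have bQ u : 0 < u <= 1 -> nrm (mpow u Q) <= c.
  move=> u01; apply: (le_trans (cQ u u01)).
  by rewrite -[leRHS]mulr1 ler_wpM2l// powR_le1//; case/andP: u01 => /ltW -> ->.
have psk m : positive_stable (Q + m.+1%:R%:M) by exact: positive_stable_addn.
have lQ := cvg_euler_term psQ; have lPQ := cvg_euler_term psPQ.
have lP := cvg_mxBeta_mGamma psP psk bQ c0.
have l1 : mlim \oo (fun n => euler_term n.+1 Q *m
    (mpow n.+1%:R P *m mxBeta P (Q + n.+2%:R%:M))) (mGamma Q *m mGamma P).
  by apply: mlimM; [exact: lQ|exact: lP].
have l2 : mlim \oo (fun n => euler_term n.+1 (P + Q) *m mxBeta P Q)
    (mGamma (P + Q) *m mxBeta P Q).
  by apply: mlimMr; exact: lPQ.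
apply: (mlim_unique l2).
by apply: eq_mlim l1 => n; exact: mxBeta_shift_euler.
Qed.

End GammaInvertible.

(** * The integral representation *)

Section HypergeometricIntegral.
Context {R : realType} {N : nat}.
Local Notation mx := 'M[R[i]]_N.
Local Notation mu := (@lebesgue_measure R).
Implicit Types (A P Q : mx) (t : R) (z : R[i]).

(** (Q)_(k+1)^-1 = (Q)_k^-1 (Q + k)^-1, and the last factor is eventually
    a contraction. *)
Lemma inv_poch_bounded Q : positive_stable Q -> exists2 D : R, 0 <= D &
  forall k, nrm (invmx (poch Q k)) <= D.
Proof.
move=> psQ; pose n1 := nrm (1%:M : mx).
have n10 : 0 <= n1 := nrm_ge0 _.
pose m := (Num.trunc (nrm Q + n1)).+1.
have mE : nrm Q + n1 <= m%:R by rewrite ltW// Num.Theory.truncnS_gt.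
pose D := \sum_(j < m.+1) nrm (invmx (poch Q j)).
have D0 : 0 <= D by apply: sumr_ge0 => j _; exact: nrm_ge0.
exists D => // k; elim: k => [|k IH].
  rewrite /D (bigD1 ord0)//= lerDl; apply: sumr_ge0 => j _; exact: nrm_ge0.
have [km|mk] := leqP k.+1 m.
  rewrite /D (bigD1 (Ordinal (km : (k.+1 < m.+1)%N)))//= lerDl.
  by apply: sumr_ge0 => j _; exact: nrm_ge0.
have ub := addn_unit k psQ; have uk := poch_unit k psQ.
have -> : invmx (poch Q k.+1) = invmx (Q + k%:R%:M) *m invmx (poch Q k).
  apply: (can_inj (mulKmx (poch_unit k.+1 psQ))).
  rewrite mulmxV ?poch_unit// pochS -mulmxA (mulmxA _ (invmx (Q + _))).
  by rewrite mulmxV// mul1mx mulmxV.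
apply: (le_trans (ler_nrmM _ _)); rewrite -[leRHS]mul1r.
apply: ler_pM; rewrite ?nrm_ge0//.
set Y := invmx _.
have kY : k%:R *:r Y = 1%:M - Q *m Y.
  apply/eqP; rewrite eq_sym subr_eq; apply/eqP.
  rewrite -(mulmxV ub) -/Y mulmxDl addrC; congr (_ + _).
  by rewrite mul_scalar_mx rscaleE rmorph_nat.
have : k%:R * nrm Y <= n1 + nrm Q * nrm Y.
  have := congr1 nrm kY; rewrite nrmZ ger0_norm// => ->.
  by apply: (le_trans (ler_nrmB _ _)); rewrite lerD2l; exact: ler_nrmM.
have kr : nrm Q + n1 <= k%:R by rewrite (le_trans mE)// ler_nat.
move=> kY1; rewrite leNgt; apply/negP => Y1.
(* The norm of the identity vanishes only for matrices of size 0. *)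
have n1pos : 0 < n1.
  rewrite lt_neqAle n10 andbT eq_sym; apply/eqP => n1E.
  have z1 : (1%:M : mx) = 0 by exact: nrm0_eq0.
  by move: Y1; rewrite -[Y]mul1mx z1 mul0mx nrm0 ltr10.
have : (nrm Q + n1) * nrm Y <= n1 + nrm Q * nrm Y.
  by apply: le_trans kY1; apply: ler_wpM2r; [exact: nrm_ge0|].
rewrite mulrDl addrC lerD2r -[leRHS]mulr1 ler_pM2l//.
by rewrite leNgt Y1.
Qed.

Definition coef_0F1 Q z (k : nat) : mx := (z ^+ k / k`!%:R) *: invmx (poch Q k).

Lemma coef_0F1Z Q z t k : coef_0F1 Q (z * t%:C) k = t ^+ k *:r coef_0F1 Q z k.
Proof.
rewrite /coef_0F1 rscaleE scalerA; congr (_ *: _).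
by rewrite exprMn rmorphXn/= mulrAC mulrC.
Qed.

Lemma mlim_partial_0F1 Q z n t :
  mlim (nbhs t) (fun s => mxseries (coef_0F1 Q (z * s%:C)) n)
    (mxseries (coef_0F1 Q (z * t%:C)) n).
Proof.
have E s m : mxseries (coef_0F1 Q (z * s%:C)) m.+1 =
    mxseries (coef_0F1 Q (z * s%:C)) m + s ^+ m *:r coef_0F1 Q z m.
  by rewrite /mxseries big_nat_recr//= coef_0F1Z.
elim: n => [|n IH].
  have E0 s : mxseries (coef_0F1 Q (z * s%:C)) 0 = 0 by rewrite /mxseries big_nil.
  have h : mlim (nbhs t) (fun=> 0 : mx) 0 by exact: mlim_cst.
  by rewrite E0; apply: eq_mlim h => s; rewrite E0.
rewrite E; apply: (@eq_mlim _ _ _ _ (fun s => mxseries (coef_0F1 Q (z * s%:C)) n +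
    s ^+ n *:r coef_0F1 Q z n)); first by move=> s; rewrite E.
apply: mlimD => //; apply: mlimZ; last exact: mlim_cst.
exact: exprn_continuous.
Qed.

Lemma nrm_coef_0F1 Q (D : R) z : (forall k, nrm (invmx (poch Q k)) <= D) ->
  forall k, nrm (coef_0F1 Q z k) <= nrm (1%:M : mx) * D * exp_coeff (nrm (z%:M : mx)) k.
Proof.
move=> QD k.
have -> : coef_0F1 Q z k = k`!%:R^-1 *:r ((z%:M : mx) ^+ k *m invmx (poch Q k)).
  have -> : (z%:M : mx) ^+ k = (z ^+ k)%:M.
    elim: k => [|k IH]; first by rewrite !expr0.
    by rewrite mxpowerS IH -scalar_mxM exprS.
  rewrite mul_scalar_mx rscaleE scalerA /coef_0F1 mulrC.
  by rewrite rmorphV ?unitfE ?pnatr_eq0 -?lt0n ?fact_gt0// rmorph_nat.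
rewrite nrmZ ger0_norm ?invr_ge0//.
apply: (@le_trans _ _ (k`!%:R^-1 * (nrm (1%:M : mx) * nrm (z%:M : mx) ^+ k * D))).
  apply: ler_wpM2l; first by rewrite invr_ge0.
  apply: (le_trans (ler_nrmM _ _)); apply: ler_pM; rewrite ?nrm_ge0//.
  exact: ler_nrmX.
by rewrite /exp_coeff/=; apply: eqler; ring.
Qed.

Lemma mx0F1_dominated Q z : positive_stable Q -> exists2 K : R, 0 <= K &
  forall t, 0 < t < 1 ->
    (forall n, nrm (mxseries (coef_0F1 Q (z * t%:C)) n) <= K) /\
    mlim \oo (mxseries (coef_0F1 Q (z * t%:C))) (mx0F1 Q (z * t%:C)).
Proof.
move=> psQ; have [D D0 QD] := inv_poch_bounded psQ.
pose n1 := nrm (1%:M : mx); have n10 : 0 <= n1 := nrm_ge0 _.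
pose y := nrm (z%:M : mx); have y0 : 0 <= y := nrm_ge0 _.
exists (n1 * D * expR y); first by rewrite !mulr_ge0 ?expR_ge0.
move=> t /andP[t0 t1].
have dom k : nrm (coef_0F1 Q (z * t%:C) k) <= n1 * D * exp_coeff y k.
  rewrite coef_0F1Z nrmZ ger0_norm; last by rewrite exprn_ge0// ltW.
  apply: (@le_trans _ _ (nrm (coef_0F1 Q z k))); last exact: nrm_coef_0F1.
  rewrite -[leRHS]mul1r; apply: ler_wpM2r; first exact: nrm_ge0.
  by apply: exprn_ile1; exact: ltW.
have [h1 h2] := exp_dominated_series (mulr_ge0 n10 D0) y0 dom.
by split => //; rewrite mx0F1E.
Qed.

Lemma beta_kernelDnat P Q k t : 0 < t ->
  beta_kernel (P + k%:R%:M) Q t = t ^+ k *:r beta_kernel P Q t.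
Proof.
by move=> t0; rewrite /beta_kernel addrAC (mpowDnat _ _ t0) rscaleMl.
Qed.

Definition coef_1F2 A P Q z (k : nat) : mx :=
  (z ^+ k / k`!%:R) *: (poch A k *m invmx (poch P k) *m invmx (poch Q k)).

(** Term by term, the recurrence of Beta turns the coefficients of 0F1 into those
    of 1F2. *)
Lemma beta_coef A P Q z k : comm_mx A P -> comm_mx A Q -> comm_mx P Q ->
  positive_stable A -> positive_stable P -> positive_stable (P - A) ->
  mxBeta (A + k%:R%:M) (P - A) *m coef_0F1 Q z k =
  mxBeta A (P - A) *m coef_1F2 A P Q z k.
Proof.
move=> AP AQ PQ psA psP psPA.
have APA : comm_mx A (P - A) by apply: comm_mxB.
have := mxBeta_pochl k APA psA psPA; rewrite addrC subrK => h.
have uP := poch_unit k psP.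
have Acomm X : comm_mx A X -> comm_mx P X -> comm_mx X (mxBeta A (P - A)).
  move=> AX PX.
  exact: comm_mxBeta psA psPA (comm_mx_sym AX) (comm_mxB (comm_mx_sym PX) (comm_mx_sym AX)).
have -> : mxBeta (A + k%:R%:M) (P - A) =
    mxBeta A (P - A) *m (poch A k *m invmx (poch P k)).
  apply: (can_inj (mulKmx uP)); rewrite h.
  have c1 : comm_mx (poch P k) (mxBeta A (P - A)).
    by apply: Acomm; apply: comm_poch.
  have c2 : comm_mx (poch A k) (mxBeta A (P - A)).
    by apply: Acomm; apply: comm_poch => //; exact: comm_mx_sym.
  have c3 : comm_mx (poch P k) (poch A k).
    by apply: comm_poch; apply: comm_mx_sym; exact: comm_poch.
  rewrite mulmxA c1 -mulmxA (mulmxA (poch P k)) c3 -mulmxA mulmxV// mulmx1.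
  exact: c2.
by rewrite /coef_0F1 /coef_1F2 -!scalemxAr -!mulmxA.
Qed.

(** Dominated convergence along the partial sums of 0F1, which are bounded
    uniformly in t. *)
Lemma integral_1F2 A P Q z : comm_mx A P -> comm_mx A Q -> comm_mx P Q ->
  positive_stable A -> positive_stable P -> positive_stable Q ->
  positive_stable (P - A) ->
  let F t := beta_kernel A (P - A) t *m mx0F1 Q (z * t%:C) in
  mx_integrable `]0, 1[%classic F /\
  mlim \oo (fun n => mxBeta A (P - A) *m mxseries (coef_1F2 A P Q z) n)
    (mx_integral `]0, 1[%classic F).
Proof.
move=> AP AQ PQ psA psP psQ psPA F.
have m01 : measurable (`]0, 1[%classic : set R) by [].
have [K K0 KP] := mx0F1_dominated z psQ.
have [g ig gP] := beta_kernel_dominated psA psPA.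
pose F_ n t := beta_kernel A (P - A) t *m mxseries (coef_0F1 Q (z * t%:C)) n.
pose G k t := beta_kernel (A + k%:R%:M) (P - A) t *m coef_0F1 Q z k.
have F_E n t : 0 < t -> F_ n t = \sum_(k < n) G k t.
  move=> t0; rewrite /F_ /mxseries mulmx_sumr big_mkord; apply: eq_bigr => k _.
  by rewrite /G (beta_kernelDnat _ _ _ t0) coef_0F1Z rscaleMr rscaleMl.
have iG k := mx_integralMr (coef_0F1 Q z k) m01
  (beta_kernel_integrable (positive_stable_addn (k := k) psA) psPA).
have iS n := @mx_integral_sum R N 'I_n _ G m01 (fun k => (iG k).1).
have mF n : mx_measurable `]0, 1[%classic (F_ n).
  apply: continuous_mx_measurable; first exact: open01.
  move=> t t01; have [t0 t1] := in01 t01.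
  apply: mlimM; first exact: beta_kernel_continuous.
  exact: mlim_partial_0F1.
have igK : mu.-integrable `]0, 1[%classic (EFin \o (fun t => K * g t)).
  exact: (@integrableZl _ _ R mu _ m01 K _ ig).
have dom n t : `]0, 1[%classic t -> nrm (F_ n t) <= K * g t.
  move=> t01; have [t0 t1] := in01 t01.
  have [Kn _] := KP t (introT andP (conj t0 t1)).
  apply: (le_trans (ler_nrmM _ _)); rewrite mulrC.
  by apply: ler_pM; rewrite ?nrm_ge0// gP.
have pw t : `]0, 1[%classic t -> mlim \oo (F_ ^~ t) (F t).
  move=> t01; have [t0 t1] := in01 t01.
  have [_ Kl] := KP t (introT andP (conj t0 t1)).
  exact: mlimMl.
have [iF lim] := mx_dominated_convergence m01 mF igK dom pw.
split => //; apply: eq_mlim lim => n.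
have -> : mx_integral `]0, 1[%classic (F_ n) =
    mx_integral `]0, 1[%classic (fun t => \sum_(k < n) G k t).
  by apply: eq_mx_integral => t /in01[t0 _]; exact: F_E.
rewrite (iS n).2 /mxseries big_mkord mulmx_sumr; apply: eq_bigr => k _.
by rewrite /G (iG k).2 -mxBetaE beta_coef.
Qed.

Lemma mxGamma_mGamma P : mxGamma P = mGamma P.
Proof.
rewrite mGammaE /mxGamma; congr mx_integral; apply/funext => t.
by rewrite /gamma_kernel rscaleE mpow.unlock.
Qed.

(** The prefactor is the inverse of the Beta integral; multiplying the previous
    limit by it also shows that the 1F2 series converges. *)
Lemma hypergeometric_1F2_integral A P Q z :
  comm_mx A P -> comm_mx A Q -> comm_mx P Q ->
  positive_stable A -> positive_stable P -> positive_stable Q ->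
  positive_stable (P - A) ->
  let F t := mxpow t (A - 1%:M) *m mxpow (1 - t) (P - A - 1%:M) *m
    mx0F1 Q (z * t%:C) in
  mx_integrable `]0, 1[ F /\
  mx1F2 A P Q z = mxGamma P *m invmx (mxGamma A) *m invmx (mxGamma (P - A)) *m
    mx_integral `]0, 1[ F.
Proof.
move=> AP AQ PQ psA psP psQ psPA F.
have -> : F = (fun t => beta_kernel A (P - A) t *m mx0F1 Q (z * t%:C)).
  by apply/funext => t; rewrite /F /beta_kernel mpow.unlock.
have [iF lim] := integral_1F2 z AP AQ PQ psA psP psQ psPA.
split => //.
rewrite !mxGamma_mGamma mx1F2E.
set I := mx_integral _ _ in lim *.
have APA : comm_mx A (P - A) by exact: comm_mxB.
have PPA : comm_mx P (P - A) by apply: comm_mxB => //; exact: comm_mx_sym.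
have uA := mGamma_unit psA; have uPA := mGamma_unit psPA; have uP := mGamma_unit psP.
have psAPA : positive_stable (A + (P - A)) by rewrite addrC subrK.
have bg := mxBeta_mGamma APA psA psPA psAPA.
rewrite addrC subrK in bg.
set W := mGamma P *m _ *m _.
have WB : W *m mxBeta A (P - A) = 1%:M.
  have cAPA : comm_mx (mGamma (P - A)) (mGamma A).
    by apply: comm_mGamma => //; apply: comm_mx_sym; exact: comm_mGamma.
  have c1 : comm_mx (mGamma P) (invmx (mGamma A)).
    apply: comm_invmx; apply: comm_mGamma => //; apply: comm_mx_sym.
    exact: comm_mGamma.
  have c2 : comm_mx (mGamma P) (invmx (mGamma (P - A))).
    apply: comm_invmx; apply: comm_mGamma => //; apply: comm_mx_sym.
    by apply: comm_mGamma => //; exact: comm_mx_sym.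
  rewrite /W c1 -(mulmxA (invmx _) (mGamma P)) c2 -!mulmxA bg.
  by rewrite mulKmx// mulVmx.
apply: mlim_limn.
have Wlim : mlim \oo (fun n => W *m (mxBeta A (P - A) *m mxseries (coef_1F2 A P Q z) n)) (W *m I).
  exact: mlimMl.
by apply: eq_mlim Wlim => n; rewrite mulmxA WB mul1mx.
Qed.

End HypergeometricIntegral.

Theorem theorem2p4 (R : realType) (N : nat) (A B C : 'M[R[i]]_N)
  (cAB : comm_mx A B) (cAC : comm_mx A C) (cBC : comm_mx B C)
  (psA : positive_stable A) (psB : positive_stable B) (psC : positive_stable C)
  (psBA : positive_stable (B - A)) (uBA : B - A \in unitmx)
  (psCA : positive_stable (C - A)) (uCA : C - A \in unitmx)
  (z : R[i]) (hz : ~ exists2 x : R, 1 <= x & z = x%:C) :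
  let integrand (P Q : 'M[R[i]]_N) (t : R) : 'M[R[i]]_N :=
    mxpow t (A - 1%:M) *m mxpow (1 - t) (P - A - 1%:M) *m mx0F1 Q (z * t%:C) in
  (mx_integrable `]0, 1[ (integrand B C) /\
   mx1F2 A B C z =
     mxGamma B *m invmx (mxGamma A) *m invmx (mxGamma (B - A)) *m
     mx_integral `]0, 1[ (integrand B C)) /\
  (mx_integrable `]0, 1[ (integrand C B) /\
   mx1F2 A B C z =
     mxGamma C *m invmx (mxGamma A) *m invmx (mxGamma (C - A)) *m
     mx_integral `]0, 1[ (integrand C B)).
Proof.
move=> integrand; split; first exact: hypergeometric_1F2_integral.
have -> : mx1F2 A B C z = mx1F2 A C B z.
  rewrite !mx1F2E; congr (mxlimn (mxseries _)); apply/funext => k.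
  congr (_ *: _); rewrite -!mulmxA; congr (_ *m _).
  apply: comm_invmx; apply: comm_mx_sym; apply: comm_invmx.
  by apply: comm_poch; apply: comm_mx_sym; exact: comm_poch.
by apply: hypergeometric_1F2_integral => //; exact: comm_mx_sym.
Qed.
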